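(* Let $\mathcal I$ be a uniform parameter-interpretation, of arity $r$, of a class $\mathcal D$ of finite $L'$-structures in a class $\mathcal C$ of finite $L$-structures, and let $\mathcal P_{\mathcal I}$ be its class of interpretation pairs. If $\mathcal P_{\mathcal I}$ has separated relative quantifier elimination over the target sort and sentence descent, then $\mathcal I$ is quotient-trace reflecting. Consequently, if $\mathcal C$ is an $N$-dimensional asymptotic class, then $\mathcal D$ is an $L_Q$-dimensional asymptotic class.
   Context: Conventions. Languages $L,L'$ are countable first-order languages, possibly with finitely many sorts; function and constant symbols may be replaced by graph relations. All structures in the classes considered are finite, and $|M|$ is the total number of elements (summed over sorts). Uniform little-$o$. For a collection $\Phi$ (a ''cell'') of pairs $(M,\bar a)$, $f=o(g)$ uniformly on $\Phi$ means: for every $\varepsilon>0$ there is $Q$ with $|f(M,\bar a)|\le\varepsilon g(M,\bar a)$ for all $(M,\bar a)\in\Phi$ with $|M|>Q$. $N$-dimensional asymptotic class ($N\ge1$). A class $\mathcal C$ of finite $L$-structures such that for every $L$-formula $\varphi(x;\bar y)$ with a single object variable $x$ there are a finite set $D_\varphi\subseteq(\{0,\dots,N\}\times\mathbb R_{>0})\cup\{(0,0)\}$ and, for each $(d,\mu)\in D_\varphi$, a parameter-free $L$-formula $\theta_{d,\mu}(\bar y)$ such that in every $M\in\mathcal C$ the sets $\theta_{d,\mu}(M^{|\bar y|})$ partition $M^{|\bar y|}$, and, uniformly on the cell $\{(M,\bar a):M\models\theta_{d,\mu}(\bar a)\}$, $|\varphi(M;\bar a)|=\mu|M|^{d/N}+o(|M|^{d/N})$;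 for $(0,0)$ this means $|\varphi(M;\bar a)|=o(1)$. Uniform parameter-interpretation $\mathcal I$ of $\mathcal D$ in $\mathcal C$, of arity $r\ge1$: an injection $\alpha:\mathcal D\to\mathcal C$; an integer $s\ge0$; fixed $L$-formulas $\delta(\bar u;\bar z)$, $\epsilon(\bar u,\bar v;\bar z)$ with $|\bar u|=|\bar v|=r$, $|\bar z|=s$; for each relation symbol $R\in L'$ a fixed $L$-formula $R^{\mathcal I}$ on the appropriate number of $r$-tuples (and $\bar z$); and for each $A\in\mathcal D$ a tuple $\bar c_A\in\alpha(A)^s$ and an $L'$-isomorphism $\iota_A:A\to X_A/E_A$, where $X_A=\delta(\alpha(A)^r;\bar c_A)$ and $E_A$ is the equivalence relation on $X_A$ defined by $\epsilon(\bar u,\bar v;\bar c_A)$; the formulas $R^{\mathcal I}$ (evaluated at $\bar c_A$) are $E_A$-invariant on $X_A$ and induce the $L'$-structure on $X_A/E_A$. A representative of $a\in A$ is an element of the class $\iota_A(a)$. Quotient-trace reflecting: for every $m\ge0$ and every parameter-free $L$-formula $\rho(\bar v_1,\dots,\bar v_m;\bar z)$ (each $\bar v_i$ an $r$-tuple) such that, for every $A\in\mathcal D$, $\rho(\cdot;\bar c_A)$ is $E_A$-invariant in each $\bar v_i$ on $X_A^m$, there is a parameter-free $L'$-formula $\rho^{\downarrow}(y_1,\dots,y_m)$ such that for every $A\in\mathcal D$, all $a_1,\dots,a_m\in A$ and arbitrary representatives $\bar v_i\in X_A$ of $a_i$: $A\models\rho^{\downarrow}(a_1,\dots,a_m)\iff\alpha(A)\models\rho(\bar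 v_1,\dots,\bar v_m;\bar c_A)$. The number $L_Q$ (when $\mathcal C$ is $N$-dimensional). There is a finite family of parameter-free $L$-formulas $\chi_{e,\lambda}(\bar z)$, indexed by pairs $(e,\lambda)\in(\{0,\dots,Nr\}\times\mathbb R_{>0})\cup\{(0,0)\}$, such that for each $A\in\mathcal D$ exactly one $\chi_{e,\lambda}(\bar c_A)$ holds in $M=\alpha(A)$, and uniformly on each cell $|A|=|X_A/E_A|=\lambda|M|^{e/N}+o(|M|^{e/N})$ (as $|M|\to\infty$). Fix such a partition. Let $\mathscr E_Q$ be the set of positive $e$ for which, for some $\lambda>0$, the structures $A\in\mathcal D$ with $\alpha(A)\models\chi_{e,\lambda}(\bar c_A)$ have unbounded cardinality. Then $L_Q=\operatorname{lcm}(\mathscr E_Q)$, with $\operatorname{lcm}(\varnothing)=1$. Interpretation pairs. For $A\in\mathcal D$ and $M=\alpha(A)$, $P_A=(M,A,\bar c_A,\pi_A)$ is the two-sorted structure whose sorts carry the $L$-structure $M$ and the $L'$-structure $A$ (the target sort), with the tuple $\bar c_A$ named by constants and with the graph of the quotient map $\pi_A:X_A\to A$ induced by $A\cong X_A/E_A$. $\mathcal P_{\mathcal I}=\{P_A:A\in\mathcal D\}$; its language is the pair language. Separated relative quantifier elimination over the target sort: for every parameter-free pair-language formula $\eta(\bar y)$ with free variables in the $A$-sort there are parameter-free $L'$-formulas $\chi_1(\bar y),\dots,\chi_t(\bar y)$ and pair-language sentences $\sigma_1,\dots,\sigma_t$ such that for all $A\in\mathcal D$ and $\bar a$ from $A$: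 $P_A\models\eta(\bar a)\iff P_A\models\bigvee_{i=1}^t(\sigma_i\wedge\chi_i(\bar a))$. Sentence descent: for every parameter-free pair-language sentence $\sigma$ there is a parameter-free $L'$-sentence $\sigma^{\downarrow}$ with $P_A\models\sigma\iff A\models\sigma^{\downarrow}$ for every $A\in\mathcal D$. *)

(* Defs.v *)
From HB Require Import structures.
From mathcomp Require Import all_boot all_order all_algebra.
From mathcomp Require Import boolp reals exp.

Set Implicit Arguments.
Unset Strict Implicit.
Unset Printing Implicit Defensive.

Import Order.TTheory GRing.Theory Num.Theory.

(* [tup F [:: t1; ...; tm]] is [F t1 * (... * (F tm * unit))]. *)
Fixpoint tup (S : Type) (F : S -> finType) (ts : seq S) : finType :=
  if ts is t :: ts' then (F t * tup F ts')%type else unit.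

Fixpoint tcat (S : Type) (F : S -> finType) (G H : seq S) :
    tup F G -> tup F H -> tup F (G ++ H) :=
  match G with
  | [::] => fun _ v => v
  | _ :: _ => fun u v => (u.1, tcat u.2 v)
  end.

Fixpoint tflat (S T : Type) (F : S -> finType) (us : T -> seq S) (ts : seq T) :
    tup (fun t => tup F (us t)) ts -> tup F (flatten (map us ts)) :=
  match ts with
  | [::] => fun _ => tt
  | _ :: _ => fun v => tcat v.1 (tflat v.2)
  end.

Fixpoint tmap (S T : Type) (F : T -> finType) (g : S -> T) (ts : seq S) :
    tup (fun s => F (g s)) ts -> tup F (map g ts) :=
  match ts with
  | [::] => fun _ => tt
  | _ :: _ => fun v => (v.1, tmap v.2)
  end.

Fixpoint tunmap (S T : Type) (F : T -> finType) (g : S -> T) (ts : seq S) :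
    tup F (map g ts) -> tup (fun s => F (g s)) ts :=
  match ts with
  | [::] => fun _ => tt
  | _ :: _ => fun v => (v.1, tunmap v.2)
  end.

Fixpoint ttab (S J : Type) (F : S -> finType) (z : J -> S)
    (c : forall j, F (z j)) (js : seq J) : tup F (map z js) :=
  if js is j :: js' then (c j, ttab c js') else tt.

Fixpoint tall2 (S : Type) (F G : S -> finType) (P : forall t, F t -> G t -> bool)
    (ts : seq S) : tup F ts -> tup G ts -> bool :=
  match ts with
  | [::] => fun _ _ => true
  | _ :: _ => fun u v => P _ u.1 v.1 && tall2 P u.2 v.2
  end.

(* Functions and constants are represented by their graphs. *)
Record language := Language {
  sorts : finType;
  symbols : countType;
  profile : symbols -> seq sorts }.

(* Sorts are allowed to be empty. *)
Record structure (L : language) := Structure {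
  carrier :> sorts L -> finType;
  interp : forall P : symbols L, tup carrier (profile P) -> bool }.

Definition msize (L : language) (M : structure L) : nat :=
  \sum_(s : sorts L) #|M s|.

(* Well-sorted de Bruijn variables: [var G s] is the set of positions of [s]
   in the context [G]. *)
Inductive var (S : Type) : seq S -> S -> Type :=
| var0 s G : var (s :: G) s
| varS s t G : var G s -> var (t :: G) s.

Fixpoint vars (S : Type) (G ts : seq S) : Type :=
  if ts is t :: ts' then (var G t * vars G ts')%type else unit.

Fixpoint lookup (S : Type) (F : S -> finType) (G : seq S) (s : S)
    (x : var G s) : tup F G -> F s :=
  match x in var G s return tup F G -> F s with
  | var0 _ _ => fun a => a.1
  | varS _ _ _ x' => fun a => lookup x' a.2
  end.

Fixpoint lookups (S : Type) (F : S -> finType) (G ts : seq S) :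
    vars G ts -> tup F G -> tup F ts :=
  match ts with
  | [::] => fun _ _ => tt
  | _ :: _ => fun xs a => (lookup xs.1 a, lookups xs.2 a)
  end.

(* [formula G]: parameter-free formulas whose free variables are sorted by [G];
   the remaining connectives and the universal quantifier are definable. *)
Inductive formula (L : language) : seq (sorts L) -> Type :=
| FFalse G : formula G
| FRel G (P : symbols L) : vars G (profile P) -> formula G
| FEq G s : var G s -> var G s -> formula G
| FImp G : formula G -> formula G -> formula G
| FEx G s : formula (s :: G) -> formula G.

Arguments formula : clear implicits.
Arguments FFalse {L G}.
Arguments FRel {L G} P.
Arguments FEx {L G} s.

Definition sentence (L : language) := formula L [::].

Fixpoint sat (L : language) (M : structure L) (G : seq (sorts L))
    (phi : formula L G) : tup M G -> bool :=
  match phi in formula _ G return tup M G -> bool with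
  | FFalse _ => fun _ => false
  | FRel _ P xs => fun a => interp (lookups xs a)
  | FEq _ _ x y => fun a => lookup x a == lookup y a
  | FImp _ phi1 phi2 => fun a => sat phi1 a ==> sat phi2 a
  | FEx _ s phi1 => fun a => [exists x : M s, sat phi1 ((x, a) : tup M (s :: _))]
  end.

Definition models (L : language) (M : structure L) (sigma : sentence L) : bool :=
  sat sigma (tt : tup M [::]).

Definition class (L : language) := structure L -> Prop.
Definition member (L : language) (C : class L) := {M : structure L | C M}.
Coercion struct (L : language) (C : class L) (M : member C) : structure L :=
  sval M.

Local Open Scope ring_scope.

(* [f = o(g)] on the cell [Phi]; [size] is the |M| of the definition. *)
Definition uniform_littleo (R : realType) (I : Type) (size : I -> nat)
    (Phi : I -> Prop) (f g : I -> R) : Prop :=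
  forall eps : R, 0 < eps ->
  exists Q : nat, forall i, Phi i -> (Q < size i)%N -> `|f i| <= eps * g i.

Definition growth (R : realType) (N d n : nat) : R := n%:R `^ (d%:R / N%:R).

(* ({0, ..., K} x R_{>0}) u {(0, 0)} *)
Definition dim_meas (R : realType) (K : nat) (p : nat * R) : bool :=
  (p.1 <= K)%N && (0 < p.2) || (p == (0%N, 0)).

(* Since [growth N 0 n = 1], at the pair (0, 0) the estimate below reads
   |phi(M; a)| = o(1). *)
Definition asymptotic_class (R : realType) (N : nat) (L : language)
    (C : class L) : Prop :=
  (0 < N)%N /\
  forall (s : sorts L) (G : seq (sorts L)) (phi : formula L (s :: G)),
  exists (D : seq (nat * R)) (theta : nat * R -> formula L G),
    [/\ all (dim_meas N) D,
        forall (M : member C) (a : tup M G),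
          exists! p : nat * R, p \in D /\ sat (theta p) a
      & forall p : nat * R, p \in D ->
          uniform_littleo
            (fun i : {M : member C & tup M G} => msize (tag i))
            (fun i => sat (theta p) (tagged i))
            (fun i => #|[pred x : tag i s |
                          sat phi ((x, tagged i) : tup (tag i) (s :: G))]|%:R
                      - p.2 * growth R N p.1 (msize (tag i)))
            (fun i => growth R N p.1 (msize (tag i)))].

Definition tab_ctx (S : Type) (n : nat) (z : 'I_n -> S) : seq S :=
  [seq z j | j <- enum 'I_n].

(* The formulas of an interpretation of arity [r].  Each sort [t] of the target
   language has its own domain and equality formulas, in r-tuples sorted by
   [us t]; for a one-sorted target there is a single pair of formulas. *)
Record scheme (L L' : language) (r : nat) := Scheme {
  npar : nat;
  zs : 'I_npar -> sorts L;
  us : sorts L' -> r.-tuple (sorts L);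
  delta : forall t, formula L (us t ++ tab_ctx zs);
  epsilon : forall t, formula L (us t ++ (us t ++ tab_ctx zs));
  rel_formula : forall P : symbols L',
    formula L (flatten [seq tval (us t) | t <- profile P] ++ tab_ctx zs) }.

Arguments npar {L L' r} s.
Arguments zs {L L' r} s j.
Arguments us {L L' r} s t.
Arguments delta {L L' r} s t.
Arguments epsilon {L L' r} s t.
Arguments rel_formula {L L' r} s P.

Section Scheme.
Variables (L L' : language) (r : nat) (I : scheme L L' r).

Definition reps_ctx (ts : seq (sorts L')) : seq (sorts L) :=
  flatten [seq tval (us I t) | t <- ts].

Definition zctx : seq (sorts L) := tab_ctx (zs I).

Variables (M : structure L) (c : forall j, M (zs I j)).

Definition params : tup M zctx := ttab c (enum 'I_(npar I)).

Definition rtup (t : sorts L') : finType := tup M (us I t).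

Definition dom (t : sorts L') : {set rtup t} :=
  [set u | sat (delta I t) (tcat u params)].

Definition eqv (t : sorts L') : rel (rtup t) :=
  fun u v => sat (epsilon I t) (tcat u (tcat v params)).

Definition quotient (t : sorts L') : {set {set rtup t}} :=
  equivalence_partition (@eqv t) (dom t).

Definition trace (ts : seq (sorts L')) (rho : formula L (reps_ctx ts ++ zctx))
    (v : tup rtup ts) : bool :=
  sat rho (tcat (tflat v) params).

Definition invariant_trace (ts : seq (sorts L'))
    (rho : formula L (reps_ctx ts ++ zctx)) : Prop :=
  forall v w : tup rtup ts,
    tall2 (fun t u u' => [&& u \in dom t, u' \in dom t & eqv u u']) v w ->
    trace rho v = trace rho w.

End Scheme.

(* [iota A t a] is the class, i.e. the set of representatives, of [a]. *)
Record interpretation (L L' : language) (r : nat)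
    (C : class L) (D : class L') := Interpretation {
  syntax :> scheme L L' r;
  arity_gt0 : (0 < r)%N;
  alpha : member D -> member C;
  alpha_inj : injective alpha;
  par : forall (A : member D) j, alpha A (zs syntax j);
  eqv_equiv : forall (A : member D) t,
    {in dom (par A) t & &, equivalence_rel (@eqv _ _ _ _ _ (par A) t)};
  iota : forall (A : member D) t, A t -> {set rtup syntax (alpha A) t};
  iota_inj : forall (A : member D) t, injective (@iota A t);
  iota_onto : forall (A : member D) t,
    [set iota a | a : A t] = quotient (par A) t;
  rel_invariant : forall (A : member D) (P : symbols L'),
    invariant_trace (par A) (rel_formula syntax P);
  rel_iso : forall (A : member D) (P : symbols L') (a : tup A (profile P))
      (v : tup (rtup syntax (alpha A)) (profile P)),
    tall2 (fun t x u => u \in iota x) a v ->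
    interp a = trace (par A) (rel_formula syntax P) v }.

Arguments alpha {L L' r C D} i A.
Arguments par {L L' r C D} i A j.
Arguments iota {L L' r C D} i A {t} a.

Section Interpretation.
Variables (L L' : language) (r : nat) (C : class L) (D : class L').
Variable I : interpretation r C D.

Definition representatives (A : member D) (ts : seq (sorts L'))
    (a : tup A ts) (v : tup (rtup I (alpha I A)) ts) : bool :=
  tall2 (fun t x u => u \in iota I A x) a v.

Definition quotient_trace_reflecting : Prop :=
  forall (ts : seq (sorts L')) (rho : formula L (reps_ctx I ts ++ zctx I)),
    (forall A : member D, invariant_trace (par I A) rho) ->
    exists rho' : formula L' ts,
      forall (A : member D) (a : tup A ts) v,
        representatives a v -> sat rho' a = trace (par I A) rho v.

Record size_partition (R : realType) (N : nat) := SizePartition {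
  cells : seq (nat * R);
  chi : nat * R -> formula L (zctx I);
  cells_range : all (dim_meas (N * r)%N) cells;
  chi_partition : forall A : member D,
    exists! p : nat * R, p \in cells /\ sat (chi p) (params (par I A));
  chi_size : forall p : nat * R, p \in cells ->
    uniform_littleo
      (fun A : member D => msize (alpha I A))
      (fun A => sat (chi p) (params (par I A)))
      (fun A => (msize A)%:R - p.2 * growth R N p.1 (msize (alpha I A)))
      (fun A => growth R N p.1 (msize (alpha I A))) }.

Definition E_Q (R : realType) (N : nat) (P : size_partition R N) (e : nat) :
    Prop :=
  (0 < e)%N /\
  exists lambda : R, [/\ 0 < lambda, (e, lambda) \in cells P
    & forall B : nat, exists A : member D,
        sat (chi P (e, lambda)) (params (par I A)) /\ (B < msize A)%N].

Definition L_Q (R : realType) (N : nat) (P : size_partition R N) : nat :=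
  \big[lcmn/1%N]_(e < (N * r)%N.+1 | `[< E_Q P e >]) e.

(* The symbols are those of [L], those of [L'], a (graph of a) constant for each
   parameter, and the graph of the quotient map onto each sort of [L'], with the
   value as first argument. *)
Definition pair_profile
    (P : symbols L + symbols L' + 'I_(npar I) + sorts L') :
    seq (sorts L + sorts L') :=
  match P with
  | inl (inl (inl P)) => map inl (profile P)
  | inl (inl (inr P)) => map inr (profile P)
  | inl (inr j) => [:: inl (zs I j)]
  | inr t => inr t :: map inl (us I t)
  end.

Definition pair_language : language := Language pair_profile.

Definition pair_carrier (A : member D) (s : sorts L + sorts L') : finType :=
  match s with inl s => alpha I A s | inr t => A t end.

Definition pair_interp (A : member D) (P : symbols pair_language) :
    tup (pair_carrier A) (pair_profile P) -> bool :=
  match P return tup (pair_carrier A) (pair_profile P) -> bool with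
  | inl (inl (inl P)) => fun a => @interp L (alpha I A) P (tunmap a)
  | inl (inl (inr P)) => fun a => @interp L' A P (tunmap a)
  | inl (inr j) => fun a => a.1 == par I A j
  | inr t => fun a => (tunmap a.2 : rtup I (alpha I A) t) \in iota I A a.1
  end.

Definition interpretation_pair (A : member D) : structure pair_language :=
  Structure (@pair_interp A).

End Interpretation.

Fixpoint map_var (S T : Type) (g : S -> T) (G : seq S) (s : S) (x : var G s) :
    var (map g G) (g s) :=
  match x in var G s return var (map g G) (g s) with
  | var0 _ _ => var0 _ _
  | varS _ _ _ x' => varS _ (map_var g x')
  end.

Fixpoint map_vars (S T : Type) (g : S -> T) (G ts : seq S) :
    vars G ts -> vars (map g G) (map g ts) :=
  match ts with
  | [::] => fun _ => tt
  | _ :: _ => fun xs => (map_var g xs.1, map_vars g xs.2)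
  end.

Section Pairs.
Variables (L L' : language) (r : nat) (C : class L) (D : class L').
Variable I : interpretation r C D.

Local Notation PL := (pair_language I).

Definition target_ctx (G : seq (sorts L')) : seq (sorts PL) := map inr G.

Fixpoint to_pair (G : seq (sorts L')) (phi : formula L' G) :
    formula PL (target_ctx G) :=
  match phi in formula _ G return formula PL (target_ctx G) with
  | FFalse _ => FFalse
  | FRel _ P xs => @FRel PL _ (inl (inl (inr P))) (map_vars inr xs)
  | FEq _ _ x y => @FEq PL _ _ (map_var inr x) (map_var inr y)
  | FImp _ phi1 phi2 => FImp (to_pair phi1) (to_pair phi2)
  | FEx _ s phi1 => @FEx PL _ (inr s) (to_pair phi1)
  end.

Definition to_target (A : member D) (G : seq (sorts L')) (a : tup A G) :
    tup (interpretation_pair I A) (target_ctx G) :=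
  @tmap _ _ (interpretation_pair I A) inr G a.

Definition separated_relative_qe : Prop :=
  forall (G : seq (sorts L')) (eta : formula PL (target_ctx G)),
  exists l : seq (sentence PL * formula L' G),
  forall (A : member D) (a : tup A G),
    sat eta (to_target a) =
    has (fun p => models (interpretation_pair I A) p.1
                  && sat (to_pair p.2) (to_target a)) l.

Definition sentence_descent : Prop :=
  forall sigma : sentence PL, exists sigma' : sentence L',
  forall A : member D, models (interpretation_pair I A) sigma = models A sigma'.

End Pairs.

(* Main.v *)
Require Import Defs.
From HB Require Import structures.
From mathcomp Require Import all_boot all_order all_algebra.
From mathcomp Require Import boolp reals exp.
From mathcomp Require Import classical_sets topology normedtype derive.
From mathcomp Require Import ring.

(* A pair-language formula in target variables descends to an L'-formula by
   quantifier elimination and sentence descent.  Descending "some representatives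
   of y satisfy rho at the named parameters" gives reflection.

   For the asymptotics, call a function of (M, a) asymptotic if on each of
   finitely many definable cells it is eventually zero or equivalent to some
   mu |M|^(d/N) with d an integer, possibly negative.  Such functions are closed
   under sums, products, inverses and summation over tuples of M.  The number of
   classes of an equivalence relation on X is the sum over u in X of
   1 / |class of u|, so |A| and the sizes of L'-definable subsets of A are
   asymptotic functions of representatives, although the cells need not be
   invariant under the equivalence.  The cells of A are recovered by descending
   "some representatives lie in this cell", and dividing the exponents by the
   exponent e of |A| turns |M|^(d/N) into a multiple of |A|^(d/e). *)

Set Implicit Arguments.
Unset Strict Implicit.
Unset Printing Implicit Defensive.

Import Order.TTheory GRing.Theory Num.Theory.
Import numFieldNormedType.Exports.

(** * Definable predicates *)

Section Tuples.
Variables (S : Type) (F : S -> finType).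

Fixpoint tfst (G H : seq S) : tup F (G ++ H) -> tup F G :=
  match G with
  | [::] => fun _ => tt
  | _ :: _ => fun a => (a.1, tfst a.2)
  end.

Fixpoint tsnd (G H : seq S) : tup F (G ++ H) -> tup F H :=
  match G with
  | [::] => fun a => a
  | _ :: _ => fun a => tsnd a.2
  end.

Lemma tcat_fst_snd (G H : seq S) (a : tup F (G ++ H)) :
  tcat (tfst a) (tsnd a) = a.
Proof. by elim: G a => [|s G IH] //= [x a] /=; rewrite IH. Qed.

Lemma tfst_cat (G H : seq S) (a : tup F G) (b : tup F H) :
  tfst (tcat a b) = a.
Proof. by elim: G a => [|s G IH] /= => [[]|[x a]] //=; rewrite IH. Qed.

Lemma tsnd_cat (G H : seq S) (a : tup F G) (b : tup F H) :
  tsnd (tcat a b) = b.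
Proof. by elim: G a => [|s G IH] //= [x a]. Qed.

End Tuples.

Section Variables.
Variables (S : Type).
Implicit Types (F : S -> finType) (G H : seq S).

Fixpoint vshift s G H : vars G H -> vars (s :: G) H :=
  match H with
  | [::] => fun _ => tt
  | _ :: _ => fun xs => (varS s xs.1, vshift s xs.2)
  end.

Lemma lookups_shift F s G H (xs : vars G H) (a : tup F (s :: G)) :
  lookups (vshift s xs) a = lookups xs a.2.
Proof. by elim: H xs => [|t H IH] //= [x xs] /=; rewrite IH. Qed.

Fixpoint vget G H s (x : var H s) : vars G H -> var G s :=
  match x in var H s return vars G H -> var G s with
  | var0 _ _ => fun xs => xs.1
  | varS _ _ _ x' => fun xs => vget x' xs.2
  end.

Lemma lookup_get F G H s (x : var H s) (xs : vars G H) (a : tup F G) :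
  lookup (vget x xs) a = lookup x (lookups xs a).
Proof. by elim: x xs => [t H'|t t' H' x IH] //= [y ys] /=. Qed.

Fixpoint vcomp G H K : vars H K -> vars G H -> vars G K :=
  match K with
  | [::] => fun _ _ => tt
  | _ :: _ => fun ys xs => (vget ys.1 xs, vcomp ys.2 xs)
  end.

Lemma lookups_comp F G H K (ys : vars H K) (xs : vars G H) (a : tup F G) :
  lookups (vcomp ys xs) a = lookups ys (lookups xs a).
Proof.
by elim: K ys => [|s K IH] //= [y ys] /=; rewrite IH lookup_get.
Qed.

Fixpoint vid G : vars G G :=
  if G is s :: G' then (var0 s G', vshift s (vid G')) else tt.

Lemma lookups_id F G (a : tup F G) : lookups (vid G) a = a.
Proof.
by elim: G a => [|s G IH] /= => [[]|[x a]] //=; rewrite lookups_shift IH.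
Qed.

Fixpoint vfst G H K : vars G (H ++ K) -> vars G H :=
  match H with
  | [::] => fun _ => tt
  | _ :: _ => fun xs => (xs.1, vfst xs.2)
  end.

Lemma lookups_fst F G H K (xs : vars G (H ++ K)) (a : tup F G) :
  lookups (vfst xs) a = tfst (lookups xs a).
Proof. by elim: H xs => [|s H IH] //= [x xs] /=; rewrite IH. Qed.

Fixpoint vsnd G H K : vars G (H ++ K) -> vars G K :=
  match H with
  | [::] => fun xs => xs
  | _ :: _ => fun xs => vsnd xs.2
  end.

Lemma lookups_snd F G H K (xs : vars G (H ++ K)) (a : tup F G) :
  lookups (vsnd xs) a = tsnd (lookups xs a).
Proof. by elim: H xs => [|s H IH] //= [x xs] /=. Qed.

Fixpoint vcat G H K : vars G H -> vars G K -> vars G (H ++ K) :=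
  match H with
  | [::] => fun _ ys => ys
  | _ :: _ => fun xs ys => (xs.1, vcat xs.2 ys)
  end.

Lemma lookups_cat F G H K (xs : vars G H) (ys : vars G K) (a : tup F G) :
  lookups (vcat xs ys) a = tcat (lookups xs a) (lookups ys a).
Proof. by elim: H xs => [|s H IH] //= [x xs] /=; rewrite IH. Qed.

End Variables.

Section Maps.
Variables (S T : Type) (F : T -> finType) (g : S -> T).

Lemma tmapK (G : seq S) : cancel (@tmap S T F g G) (@tunmap S T F g G).
Proof. by elim: G => [|s G IH] /= => [[]|[x a]] //=; rewrite IH. Qed.

Lemma lookup_map_var G s (x : var G s) (a : tup F (map g G)) :
  lookup (map_var g x) a = lookup x (tunmap a).
Proof. by elim: x a => [t G'|t t' G' x IH] //= [y a] /=. Qed.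

Lemma lookups_map_vars G H (xs : vars G H) (a : tup F (map g G)) :
  tunmap (lookups (map_vars g xs) a) = lookups xs (tunmap a).
Proof.
by elim: H xs => [|s H IH] //= [x xs] /=; rewrite IH lookup_map_var.
Qed.

End Maps.

Fixpoint rename (L : language) (H : seq (sorts L)) (phi : formula L H) :
    forall G, vars G H -> formula L G :=
  match phi in formula _ H return forall G, vars G H -> formula L G with
  | FFalse _ => fun _ _ => FFalse
  | FRel _ P ys => fun _ xs => FRel P (vcomp ys xs)
  | FEq _ _ x y => fun _ xs => FEq (vget x xs) (vget y xs)
  | FImp _ phi1 phi2 => fun _ xs => FImp (rename phi1 xs) (rename phi2 xs)
  | FEx _ s phi1 => fun G xs =>
      FEx s (@rename L _ phi1 (s :: G) (var0 s G, vshift s xs))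
  end.

Lemma sat_rename (L : language) (M : structure L) H (phi : formula L H) G
    (xs : vars G H) (a : tup M G) :
  sat (rename phi xs) a = sat phi (lookups xs a).
Proof.
elim: phi G xs a => /=
  [//|K P ys|K s x y|K phi IH psi IH'|K s phi IH] G xs a /=.
- by rewrite lookups_comp.
- by rewrite !lookup_get.
- by rewrite IH IH'.
by apply: eq_existsb => x; rewrite IH /= lookups_shift.
Qed.

Section Definability.
Variables (L : language) (K : Type) (St : K -> structure L).
Implicit Types G H : seq (sorts L).

Definition definable G (P : forall k, tup (St k) G -> bool) : Prop :=
  exists phi : formula L G, forall k a, sat phi a = P k a.

Definition projection G H (f : forall k, tup (St k) G -> tup (St k) H) : Prop :=
  exists xs : vars G H, forall k a, f k a = lookups xs a.

Lemma definable_sat G (phi : formula L G) :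
  definable (fun k (a : tup (St k) G) => sat phi a).
Proof. by exists phi. Qed.

Lemma definable_eq G (P Q : forall k, tup (St k) G -> bool) :
  (forall k a, P k a = Q k a) -> definable P -> definable Q.
Proof. by move=> PQ [phi E]; exists phi => k a; rewrite E PQ. Qed.

Lemma definable_comp G H (P : forall k, tup (St k) H -> bool)
    (f : forall k, tup (St k) G -> tup (St k) H) :
  definable P -> projection f -> definable (fun k a => P k (f k a)).
Proof.
move=> [phi E] [xs Ef]; exists (rename phi xs) => k a.
by rewrite sat_rename E Ef.
Qed.

Lemma definable_false G : definable (fun k (a : tup (St k) G) => false).
Proof. by exists FFalse. Qed.

Lemma definable_imp G (P Q : forall k, tup (St k) G -> bool) :
  definable P -> definable Q -> definable (fun k a => P k a ==> Q k a).
Proof.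
by move=> [phi E] [psi E']; exists (FImp phi psi) => k a /=; rewrite E E'.
Qed.

Lemma definable_neg G (P : forall k, tup (St k) G -> bool) :
  definable P -> definable (fun k a => ~~ P k a).
Proof.
move=> dP; apply: definable_eq (definable_imp dP (definable_false G)) => k a.
by rewrite implybF.
Qed.

Lemma definable_true G : definable (fun k (a : tup (St k) G) => true).
Proof. exact: definable_eq (definable_neg (definable_false G)). Qed.

Lemma definable_or G (P Q : forall k, tup (St k) G -> bool) :
  definable P -> definable Q -> definable (fun k a => P k a || Q k a).
Proof.
move=> dP dQ; apply: definable_eq (definable_imp (definable_neg dP) dQ) => k a.
by case: (P k a).
Qed.

Lemma definable_and G (P Q : forall k, tup (St k) G -> bool) :
  definable P -> definable Q -> definable (fun k a => P k a && Q k a).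
Proof.
move=> dP dQ.
apply: definable_eq (definable_neg (definable_imp dP (definable_neg dQ))) => k a.
by case: (P k a); rewrite //= negbK.
Qed.

Lemma definable_ex1 G s (P : forall k, tup (St k) (s :: G) -> bool) :
  definable P ->
  definable (fun k a => [exists x, P k ((x, a) : tup (St k) (s :: G))]).
Proof.
by move=> [phi E]; exists (FEx s phi) => k a /=; apply: eq_existsb => x; exact: E.
Qed.

Lemma definable_ex G H (P : forall k, tup (St k) (H ++ G) -> bool) :
  definable P -> definable (fun k a => [exists w : tup (St k) H, P k (tcat w a)]).
Proof.
elim: H P => [|s H IH] P dP.
  apply: definable_eq dP => k a; apply/idP/existsP => [Pa|[[]]] //.
  by exists tt.
apply: definable_eq (IH _ (definable_ex1 dP)) => k a; apply/existsP/existsP.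
  by move=> [w /existsP[x Pxw]]; exists (x, w).
by move=> [[x w] Pxw]; exists w; apply/existsP; exists x.
Qed.

Lemma definable_has (T : Type) G (P : T -> forall k, tup (St k) G -> bool)
    (l : seq T) :
  (forall t, definable (P t)) ->
  definable (fun k a => has (fun t => P t k a) l).
Proof.
move=> dP; elim: l => [|t l IH] /=; first exact: definable_false.
exact: definable_or.
Qed.

Lemma definable_exists (T : finType) G (P : T -> forall k, tup (St k) G -> bool) :
  (forall t, definable (P t)) ->
  definable (fun k a => [exists t, P t k a]).
Proof.
move=> dP; apply: definable_eq (definable_has (enum T) dP) => k a.
apply/hasP/existsP => [[t _ Pt]|[t Pt]]; first by exists t.
by exists t; rewrite ?mem_enum.
Qed.

Lemma definable_forall (T : finType) G (P : T -> forall k, tup (St k) G -> bool) :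
  (forall t, definable (P t)) ->
  definable (fun k a => [forall t, P t k a]).
Proof.
move=> dP.
apply: definable_eq (definable_neg (definable_exists
  (fun t => definable_neg (dP t)))) => k a.
by rewrite negb_exists; apply: eq_forallb => t; rewrite negbK.
Qed.

Lemma definable_const G (b : bool) : definable (fun k (a : tup (St k) G) => b).
Proof. by case: b; [exact: definable_true | exact: definable_false]. Qed.

Lemma definable_eqb G (P : forall k, tup (St k) G -> bool) b :
  definable P -> definable (fun k a => P k a == b).
Proof.
move=> dP; case: b; first by apply: definable_eq dP => k a; rewrite eqb_id.
by apply: definable_eq (definable_neg dP) => k a; rewrite eqbF_neg.
Qed.

Lemma projection_id G : projection (fun k (a : tup (St k) G) => a).
Proof. by exists (vid G) => k a; rewrite lookups_id. Qed.

Lemma projection_fst G H J (f : forall k, tup (St k) G -> tup (St k) (H ++ J)) :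
  projection f -> projection (fun k a => tfst (f k a)).
Proof. by move=> [xs Ef]; exists (vfst xs) => k a; rewrite lookups_fst Ef. Qed.

Lemma projection_snd G H J (f : forall k, tup (St k) G -> tup (St k) (H ++ J)) :
  projection f -> projection (fun k a => tsnd (f k a)).
Proof. by move=> [xs Ef]; exists (vsnd xs) => k a; rewrite lookups_snd Ef. Qed.

Lemma projection_cat G H J (f : forall k, tup (St k) G -> tup (St k) H)
    (h : forall k, tup (St k) G -> tup (St k) J) :
  projection f -> projection h -> projection (fun k a => tcat (f k a) (h k a)).
Proof.
by move=> [xs Ef] [ys Eh]; exists (vcat xs ys) => k a; rewrite lookups_cat Ef Eh.
Qed.

End Definability.

(** * Descent from the interpretation pair *)

Section Representatives.
Variables (L L' : language) (r : nat) (C : class L) (D : class L').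
Variable I : interpretation r C D.

Lemma tflat_onto (M : structure L) ts (w : tup M (reps_ctx I ts)) :
  exists v : tup (rtup I M) ts, w = tflat v.
Proof.
elim: ts w => [|t ts IH] w; first by exists tt; case: w.
have [v Ev] := IH (tsnd (w : tup M (us I t ++ reps_ctx I ts))).
exists (tfst (w : tup M (us I t ++ reps_ctx I ts)), v).
by rewrite /= -[RHS]/(tcat _ (tflat v)) -Ev tcat_fst_snd.
Qed.

Fixpoint reprel (A : member D) (ts : seq (sorts L')) :
    tup (alpha I A) (reps_ctx I ts) -> tup A ts -> bool :=
  match ts return tup (alpha I A) (reps_ctx I ts) -> tup A ts -> bool with
  | [::] => fun _ _ => true
  | t :: ts' => fun w a =>
      (tfst (w : tup (alpha I A) (us I t ++ reps_ctx I ts')) \in Defs.iota I A a.1)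
      && reprel (tsnd (w : tup (alpha I A) (us I t ++ reps_ctx I ts'))) a.2
  end.

Lemma representativesE (A : member D) ts (a : tup A ts) v :
  representatives a v = reprel (tflat v) a.
Proof.
elim: ts a v => [|t ts IH] //= [x a] [u v] /=.
rewrite /representatives /= in IH *.
by rewrite tfst_cat IH; congr (_ && reprel _ _); rewrite tsnd_cat.
Qed.

Lemma iota_equiv (A : member D) t (x y : A t) u v :
  u \in Defs.iota I A x -> v \in Defs.iota I A y ->
  [/\ u \in dom (par I A) t, v \in dom (par I A) t
    & (x == y) = eqv (par I A) u v].
Proof.
move=> ux vy; have eqE := @eqv_equiv _ _ _ _ _ I A t.
have /and3P[/eqP cov triv n0] := equivalence_partitionP eqE.
have Q z : Defs.iota I A z \in quotient (par I A) t by rewrite -iota_onto imset_f.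
have ud : u \in dom (par I A) t by rewrite -cov; apply/bigcupP; exists (Defs.iota I A x).
have vd : v \in dom (par I A) t by rewrite -cov; apply/bigcupP; exists (Defs.iota I A y).
split=> //; rewrite -(pblock_equivalence_partition eqE ud vd).
rewrite (def_pblock triv (Q x) ux); apply/eqP/idP => [->//|vx].
apply: (@iota_inj _ _ _ _ _ I A t).
by rewrite -(def_pblock triv (Q x) vx) (def_pblock triv (Q y) vy).
Qed.

Lemma iota_neq0 (A : member D) t (x : A t) : exists u, u \in Defs.iota I A x.
Proof.
have eqE := @eqv_equiv _ _ _ _ _ I A t.
have /and3P[_ _ n0] := equivalence_partitionP eqE.
apply/set0Pn; apply: contraNneq n0 => <-.
by rewrite -/(quotient (par I A) t) -iota_onto imset_f.
Qed.

Lemma domP (A : member D) t u :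
  u \in dom (par I A) t -> exists x : A t, u \in Defs.iota I A x.
Proof.
move=> ud; have eqE := @eqv_equiv _ _ _ _ _ I A t.
have /and3P[/eqP cov _ _] := equivalence_partitionP eqE.
move: ud; rewrite -cov => /bigcupP[B].
rewrite -/(quotient (par I A) t) -iota_onto.
by move=> /imsetP[x _ ->]; exists x.
Qed.

Lemma reprel_onto (A : member D) ts (a : tup A ts) : exists w, reprel w a.
Proof.
elim: ts a => [|t ts IH] /= => [_|[x a]]; first by exists tt.
have [u ux] := iota_neq0 x; have [w wa] := IH a.
by exists (tcat u w); rewrite tfst_cat tsnd_cat ux.
Qed.

Local Notation PL := (pair_language I).
Local Notation PA := (interpretation_pair I).

Lemma pair_sat H (phi : formula L H) :
  exists psi : formula PL (map inl H), forall A (a : tup (PA A) (map inl H)),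
    sat psi a = sat phi (tunmap a : tup (alpha I A) H).
Proof.
elim: phi => {H} [H|H P xs|H s x y|H phi [psi E] phi' [psi' E']|H s phi [psi E]].
- by exists FFalse.
- exists (@FRel PL _ (inl (inl (inl P))) (map_vars inl xs)) => A a /=.
  by rewrite lookups_map_vars.
- exists (@FEq PL _ _ (map_var inl x) (map_var inl y)) => A a /=.
  by rewrite !lookup_map_var.
- by exists (FImp psi psi') => A a /=; rewrite E E'.
exists (@FEx PL _ (inl s) psi) => A a /=.
by apply: eq_existsb => x; rewrite E.
Qed.

Lemma sat_to_pair G (phi : formula L' G) A (a : tup (PA A) (target_ctx I G)) :
  sat (to_pair I phi) a = sat phi (tunmap a : tup A G).
Proof.
elim: phi a => {G} [G|G P xs|G s x y|G phi IH phi' IH'|G s phi IH] a //=.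
- by rewrite lookups_map_vars.
- by rewrite !lookup_map_var.
- by rewrite IH IH'.
by apply: eq_existsb => x; rewrite IH.
Qed.

Definition source_projection G H
    (f : forall A, tup (PA A) G -> tup (alpha I A) H) : Prop :=
  exists xs : vars G (map inl H),
    forall A a, f A a = tunmap (lookups xs a : tup (PA A) (map inl H)).

Definition target_projection G H
    (f : forall A, tup (PA A) G -> tup A H) : Prop :=
  exists xs : vars G (map inr H),
    forall A a, f A a = tunmap (lookups xs a : tup (PA A) (map inr H)).

Lemma source_projection_fst G H J
    (f : forall A, tup (PA A) G -> tup (alpha I A) (H ++ J)) :
  source_projection f -> source_projection (fun A a => tfst (f A a)).
Proof.
move=> [xs Ef]; elim: H f xs Ef => [|s H IH] f xs Ef /=; first by exists tt.
have [|ys Ey] := IH (fun A a => (f A a).2) xs.2; first by move=> A a; rewrite Ef.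
exists (xs.1, ys) => A a /=; congr (_, _).
  by rewrite Ef.
exact: Ey.
Qed.

Lemma source_projection_snd G H J
    (f : forall A, tup (PA A) G -> tup (alpha I A) (H ++ J)) :
  source_projection f -> source_projection (fun A a => tsnd (f A a)).
Proof.
move=> [xs Ef]; elim: H f xs Ef => [|s H IH] f xs Ef /=; first by exists xs.
by apply: (IH (fun A a => (f A a).2) xs.2) => A a; rewrite Ef.
Qed.

Lemma definable_source G H (phi : formula L H)
    (f : forall A, tup (PA A) G -> tup (alpha I A) H) :
  source_projection f -> definable (fun A a => sat phi (f A a)).
Proof.
move=> [xs Ef]; have [psi E] := pair_sat phi.
by exists (rename psi xs) => A a; rewrite sat_rename E Ef.
Qed.

Lemma definable_par G js
    (f : forall A, tup (PA A) G -> tup (alpha I A) (map (zs I) js)) :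
  source_projection f -> definable (fun A a => f A a == ttab (par I A) js).
Proof.
move=> [xs Ef]; elim: js f xs Ef => [|j js IH] f xs Ef /=.
  by apply: definable_eq (definable_true _ _) => A a; case: (f A a).
have [|psi E] := IH (fun A a => (f A a).2) xs.2; first by move=> A a; rewrite Ef.
exists (FImp (FImp (@FRel PL _ (inl (inr j)) (xs.1, tt)) (FImp psi FFalse)) FFalse).
move=> A a /=; rewrite E !implybF negb_imply negbK Ef /=.
by rewrite xpair_eqE.
Qed.

Lemma definable_reprel G ts
    (f : forall A, tup (PA A) G -> tup (alpha I A) (reps_ctx I ts))
    (y : forall A, tup (PA A) G -> tup A ts) :
  source_projection f -> target_projection y ->
  definable (fun A a => reprel (f A a) (y A a)).
Proof.
move=> sf [ys Ey]; elim: ts f sf y ys Ey => [|t ts IH] f sf y ys Ey /=.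
  exact: definable_true.
have [xs Ex] := source_projection_fst (H := us I t) (J := reps_ctx I ts) sf.
apply: definable_and; last first.
  apply: (IH _ (source_projection_snd (H := us I t) sf)
    (fun A a => (y A a).2) ys.2).
  by move=> A a; rewrite Ey.
exists (@FRel PL _ (inr t) (ys.1, xs)) => A a /=.
by rewrite Ex Ey.
Qed.

Lemma definable_source_ex G H
    (P : forall A, tup (alpha I A) H -> tup (PA A) G -> bool) :
  definable (fun A (a : tup (PA A) (map inl H ++ G)) =>
    P A (tunmap (tfst a)) (tsnd a)) ->
  definable (fun A a => [exists w, P A w a]).
Proof.
move=> /definable_ex; apply: definable_eq => A a; apply/existsP/existsP.
  by move=> [w]; rewrite tfst_cat tsnd_cat; exists (tunmap w).
move=> [w Pw]; exists (@tmap _ _ (PA A) inl _ w).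
by rewrite tfst_cat tsnd_cat tmapK.
Qed.

Lemma descent G (eta : formula PL (target_ctx I G)) :
  separated_relative_qe I -> sentence_descent I ->
  exists psi : formula L' G, forall (A : member D) (a : tup A G),
    sat psi a = sat eta (to_target I a).
Proof.
move=> qe sd; have [l El] := qe G eta.
have /choice[down Ed] := sd.
have [psi E] : definable (fun (A : member D) (a : tup A G) =>
    has (fun p => sat (rename (down p.1) (tt : vars G [::])) a && sat p.2 a) l).
  by apply: definable_has => p; apply: definable_and; exact: definable_sat.
exists psi => A a; rewrite El E; apply: eq_has => p.
by rewrite sat_rename Ed sat_to_pair tmapK.
Qed.

Lemma trace_descent ts (theta : formula L (reps_ctx I ts ++ zctx I)) :
  separated_relative_qe I -> sentence_descent I ->
  exists psi : formula L' ts, forall (A : member D) (a : tup A ts),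
    sat psi a =
    [exists w, reprel w a && sat theta (tcat w (params (par I A)))].
Proof.
move=> qe sd.
pose P A (h : tup (alpha I A) (reps_ctx I ts ++ zctx I))
    (a : tup (PA A) (target_ctx I ts)) :=
  [&& reprel (tfst h) (tunmap a), tsnd h == params (par I A) & sat theta h].
have [|eta E] := @definable_source_ex _ _ P.
  have sh : source_projection (fun A
      (a : tup (PA A) (map inl (reps_ctx I ts ++ zctx I) ++ target_ctx I ts)) =>
      tunmap (tfst a) : tup (alpha I A) _).
    exists (vfst (vid _)) => A a.
    by rewrite lookups_fst lookups_id.
  have ty : target_projection (fun A
      (a : tup (PA A) (map inl (reps_ctx I ts ++ zctx I) ++ target_ctx I ts)) =>
      tunmap (tsnd a) : tup A ts).
    exists (vsnd (vid _)) => A a.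
    by rewrite lookups_snd lookups_id.
  apply: definable_and.
    exact: definable_reprel (source_projection_fst sh) ty.
  apply: definable_and; last exact: definable_source.
  exact: definable_par (source_projection_snd sh).
have [psi Epsi] := descent eta qe sd.
exists psi => A a; rewrite Epsi E; apply/existsP/existsP.
  move=> [h /and3P[]]; rewrite tmapK => ra /eqP <- th.
  by exists (tfst h); rewrite ra tcat_fst_snd.
move=> [w /andP[ra th]]; exists (tcat w (params (par I A))).
by rewrite /P tfst_cat tsnd_cat tmapK ra eqxx.
Qed.

Lemma reps_equiv (A : member D) ts (a : tup A ts) v w :
  representatives a v -> representatives a w ->
  tall2 (fun t u u' => [&& u \in dom (par I A) t, u' \in dom (par I A) t
    & eqv (par I A) u u']) v w.
Proof.
elim: ts a v w => [|t ts IH] //= [x a] [u v] [u' w].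
rewrite /representatives /= => /andP[ux va] /andP[u'x wa].
rewrite (IH a) // andbT.
by have [-> -> <-] := iota_equiv ux u'x; rewrite eqxx.
Qed.

Lemma qe_descent_reflecting :
  separated_relative_qe I -> sentence_descent I -> quotient_trace_reflecting I.
Proof.
move=> qe sd ts rho inv; have [psi E] := trace_descent rho qe sd.
exists psi => A a v rv; rewrite E; apply/existsP/idP.
  move=> [w]; have [v' ->] := tflat_onto w.
  rewrite -representativesE => /andP[rv' tr].
  by rewrite (inv A v v') //; exact: reps_equiv rv rv'.
by exists (tflat v); rewrite -representativesE rv.
Qed.

End Representatives.

(** * Translation of target formulas *)

Section Translation.
Variables (L L' : language) (r : nat) (C : class L) (D : class L').
Variable I : interpretation r C D.

Lemma reprel_lookup G t (x : var G t) :
  exists xs : vars (reps_ctx I G) (us I t),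
  forall (A : member D) w (a : tup A G),
    reprel w a -> lookups xs w \in Defs.iota I A (lookup x a).
Proof.
elim: x => {G t} [t G|s t G x [xs IH]].
  exists (@vfst _ _ (us I t) (reps_ctx I G) (vid (us I t ++ reps_ctx I G))).
  by move=> A w a /andP[wa _]; rewrite lookups_fst lookups_id.
exists (vcomp xs (@vsnd _ _ (us I t) (reps_ctx I G) (vid (us I t ++ reps_ctx I G)))).
move=> A w a /andP[_ wa].
by rewrite lookups_comp lookups_snd lookups_id; exact: IH.
Qed.

Lemma reprel_lookups G H (xs : vars G H) :
  exists ys : vars (reps_ctx I G) (reps_ctx I H),
  forall (A : member D) w (a : tup A G),
    reprel w a -> reprel (lookups ys w) (lookups xs a).
Proof.
elim: H xs => [|t H IH] xs; first by exists tt.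
have [ys Ey] := reprel_lookup xs.1; have [zs Ez] := IH xs.2.
exists (@vcat _ _ (us I t) (reps_ctx I H) ys zs) => A w a wa /=.
have -> : lookups (@vcat _ _ (us I t) (reps_ctx I H) ys zs) w =
  tcat (lookups ys w) (lookups zs w) by rewrite lookups_cat.
by rewrite tfst_cat tsnd_cat Ey ?Ez.
Qed.

Local Notation MA := (fun A : member D => alpha I A : structure L).

Lemma translate G (phi : formula L' G) :
  exists psi : formula L (reps_ctx I G ++ zctx I),
  forall (A : member D) w (a : tup A G),
    reprel w a -> sat psi (tcat w (params (par I A))) = sat phi a.
Proof.
elim: phi => {G} [G|G P xs|G t x y|G phi [psi E] phi' [psi' E']|G t phi [psi E]].
- by exists FFalse.
- have [ys Ey] := reprel_lookups xs.
  exists (rename (rel_formula I P) (vcat (vcomp ys (vfst (vid _))) (vsnd (vid _)))).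
  move=> A w a wa; rewrite sat_rename lookups_cat lookups_comp.
  rewrite lookups_fst lookups_snd lookups_id tfst_cat tsnd_cat /=.
  have := Ey _ _ _ wa; have [v ->] := tflat_onto (lookups ys w).
  by rewrite -representativesE => /rel_iso ->.
- have [xs Ex] := reprel_lookup x; have [ys Ey] := reprel_lookup y.
  exists (rename (epsilon I t) (vcat (vcomp xs (vfst (vid _)))
    (vcat (vcomp ys (vfst (vid _))) (vsnd (vid _))))).
  move=> A w a wa; rewrite sat_rename !lookups_cat !lookups_comp.
  rewrite lookups_fst lookups_snd lookups_id tfst_cat tsnd_cat /=.
  by have [_ _ ->] := iota_equiv (Ex _ _ _ wa) (Ey _ _ _ wa).
- by exists (FImp psi psi') => A w a wa /=; rewrite (E _ _ _ wa) (E' _ _ _ wa).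
have Eproj : projection (fun A (b : tup (MA A) (us I t ++ (reps_ctx I G ++ zctx I))) =>
    tcat (tcat (tfst b) (tfst (tsnd b)) : tup (MA A) (reps_ctx I (t :: G)))
      (tsnd (tsnd b))).
  have i := projection_id MA (us I t ++ (reps_ctx I G ++ zctx I)).
  have s := projection_snd i.
  apply: projection_cat (projection_snd s).
  exact: projection_cat (projection_fst i) (projection_fst s).
have dproj : projection (fun A (b : tup (MA A) (us I t ++ (reps_ctx I G ++ zctx I))) =>
    tcat (tfst b) (tsnd (tsnd b))).
  have i := projection_id MA (us I t ++ (reps_ctx I G ++ zctx I)).
  exact: projection_cat (projection_fst i) (projection_snd (projection_snd i)).
have [psi' E'] := definable_ex (definable_and
  (definable_comp (definable_sat MA (delta I t)) dproj)
  (definable_comp (definable_sat MA psi) Eproj)).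
exists psi' => A w a wa; rewrite E' /=; apply/existsP/existsP.
  move=> [u]; rewrite tfst_cat !tsnd_cat tfst_cat => /andP[ud su].
  have [|x ux] := @domP _ _ _ _ _ I A t u; first by rewrite inE.
  exists x; rewrite -(E _ (tcat u w : tup _ (reps_ctx I (t :: G)))) //=.
  by rewrite tfst_cat ux tsnd_cat.
move=> [x sx]; have [u ux] := iota_neq0 I x; exists u.
rewrite tfst_cat !tsnd_cat tfst_cat (E _ _ (x, a)) /=; last first.
  by rewrite tfst_cat ux tsnd_cat.
rewrite sx andbT.
by have [+ _ _] := iota_equiv ux ux; rewrite inE.
Qed.

Lemma card_target (R : realType) (A : member D) t (p : pred (A t))
    (q : pred (rtup I (alpha I A) t)) :
  (forall x u, u \in Defs.iota I A x -> q u = p x) ->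
  (#|[pred x | p x]|%:R = \sum_u ((u \in dom (par I A) t) && q u)%:R *
     (\sum_v ((v \in dom (par I A) t) && eqv (par I A) u v)%:R)^-1 :> R)%R.
Proof.
move=> qp.
have size_class u x : u \in Defs.iota I A x ->
    (\sum_v ((v \in dom (par I A) t) && eqv (par I A) u v)%:R)%R
    = (#|Defs.iota I A x|%:R : R)%R.
  move=> ux; rewrite -sum1_card natr_sum [RHS]big_mkcond /=.
  apply: eq_bigr => v _.
  suff -> : (v \in dom (par I A) t) && eqv (par I A) u v = (v \in Defs.iota I A x).
    by case: (_ \in _).
  apply/andP/idP => [[vd uv]|vx]; last first.
    by have [_ -> <-] := iota_equiv ux vx.
  have [y vy] := domP vd; have [_ _] := iota_equiv ux vy.
  by rewrite uv => /eqP ->.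
transitivity (\sum_u \sum_(x | u \in Defs.iota I A x)
    (p x)%:R / (#|Defs.iota I A x|%:R : R))%R.
  rewrite (exchange_big_dep xpredT) //= -sum1_card natr_sum big_mkcond /=.
  apply: eq_bigr => x _; rewrite sumr_const -[RHS]mulr_natr inE.
  have n0 : (#|Defs.iota I A x|%:R != 0 :> R)%R.
    have [u ux] := iota_neq0 I x.
    by rewrite pnatr_eq0 -lt0n; apply/card_gt0P; exists u.
  by rewrite divfK //; case: (p x).
apply: eq_bigr => u _; have [ud|nud] := boolP (u \in _) => /=; last first.
  rewrite mul0r big1 // => x ux; case/negP: nud.
  by have [] := iota_equiv ux ux.
have [x ux] := domP ud; rewrite (size_class _ _ ux) (qp _ _ ux).
rewrite (bigD1 x) //= big1 ?addr0 // => y /andP[uy /negP[]].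
by have [_ _ ->] := iota_equiv uy ux; have [_ _ <-] := iota_equiv ux ux.
Qed.

End Translation.

Local Open Scope classical_set_scope.
Local Open Scope ring_scope.

(** * Asymptotic estimates *)

Section Power.
Variables (R : realType) (N : nat).
Hypothesis N_gt0 : (0 < N)%N.

Definition zgrowth (d : int) (n : nat) : R := n%:R `^ (d%:~R / N%:R).

Lemma zgrowth_nat (d : nat) n : zgrowth d n = growth R N d n.
Proof. by []. Qed.

Lemma zgrowth_gt0 d n : (0 < n)%N -> 0 < zgrowth d n.
Proof. by move=> n0; rewrite powR_gt0 // ltr0n. Qed.

Lemma zgrowthD d e n : (0 < n)%N -> zgrowth (d + e) n = zgrowth d n * zgrowth e n.
Proof.
move=> n0; rewrite /zgrowth rmorphD mulrDl powRD //.
by rewrite pnatr_eq0 -lt0n n0 implybT.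
Qed.

Lemma zgrowthN d n : zgrowth (- d) n = (zgrowth d n)^-1.
Proof. by rewrite /zgrowth rmorphN mulNr powRN. Qed.

Lemma zgrowth0 n : zgrowth 0 n = 1.
Proof. by rewrite /zgrowth mul0r powRr0. Qed.

End Power.

Lemma powR_small (R : realType) (a eps : R) : a < 0 -> 0 < eps ->
  exists Q : nat, forall n, (Q < n)%N -> n%:R `^ a <= eps.
Proof.
move=> a0 eps0; have an0 : a != 0 by rewrite lt_eqF.
have a'0 : 0 < - a by rewrite oppr_gt0.
exists (Num.truncn (eps `^ a^-1)) => n ltn.
have le_n : eps `^ a^-1 <= n%:R.
  by rewrite (le_trans (ltW (truncnS_gt _))) // ler_nat.
have n0 : 0 < n%:R :> R by rewrite ltr0n (leq_trans _ ltn).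
rewrite -[a]opprK powRN -[leRHS]invrK lef_pV2 ?posrE ?invr_gt0 ?powR_gt0 //.
apply: le_trans (ge0_ler_powR (ltW a'0) _ _ le_n); rewrite ?nnegrE ?powR_ge0 //.
by rewrite -powRrM mulrN mulVf // powR_inv1 // ltW.
Qed.

Section Far.
Variables (R : realType) (J : Type) (sz : J -> nat).
Implicit Types (Phi : J -> Prop) (f h : J -> R) (l m : R).

Definition far Phi (P : J -> Prop) : Prop :=
  exists Q : nat, forall i, Phi i -> (Q < sz i)%N -> P i.

(* Convergence as [sz] tends to infinity, uniform on the cell [Phi]; the index
   types used below are too large for the filters of MathComp-Analysis. *)
Definition tends Phi f l : Prop :=
  forall eps : R, 0 < eps -> far Phi (fun i => `|f i - l| <= eps).

Lemma far_all Phi (P : J -> Prop) : (forall i, P i) -> far Phi P.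
Proof. by move=> H; exists 0%N. Qed.

Lemma far_mp Phi (P P' : J -> Prop) :
  (forall i, (0 < sz i)%N -> P i -> P' i) -> far Phi P -> far Phi P'.
Proof.
move=> PP' [Q H]; exists Q => i Phii Qi.
by apply: PP'; [exact: leq_ltn_trans Qi | exact: H].
Qed.

Lemma far_and Phi (P P' : J -> Prop) :
  far Phi P -> far Phi P' -> far Phi (fun i => P i /\ P' i).
Proof.
move=> [p Pp] [q Qq]; exists (maxn p q) => i Phii; rewrite gtn_max => /andP[pi qi].
by split; [exact: Pp | exact: Qq].
Qed.

Lemma far_mono Phi Psi (P : J -> Prop) :
  (forall i, Psi i -> Phi i) -> far Phi P -> far Psi P.
Proof. by move=> PsiPhi [Q H]; exists Q => i /PsiPhi; exact: H. Qed.

Lemma tends_eq Phi f h l :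
  far Phi (fun i => f i = h i) -> tends Phi f l -> tends Phi h l.
Proof.
move=> fh H eps /H {}H; apply: far_mp (far_and fh H) => i _ [-> //].
Qed.

Lemma tends_cst Phi l : tends Phi (fun=> l) l.
Proof. by move=> eps /ltW eps0; apply: far_all => i; rewrite subrr normr0. Qed.

Lemma tendsD Phi f h l m :
  tends Phi f l -> tends Phi h m -> tends Phi (fun i => f i + h i) (l + m).
Proof.
move=> fl hm eps eps0; have e2 : 0 < eps / 2 by rewrite divr_gt0.
apply: far_mp (far_and (fl _ e2) (hm _ e2)) => i _ [H H'].
by rewrite opprD addrACA (le_trans (ler_normD _ _)) // [leRHS]splitr lerD.
Qed.

Lemma tendsM Phi f h l m :
  tends Phi f l -> tends Phi h m -> tends Phi (fun i => f i * h i) (l * m).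
Proof.
move=> fl hm eps eps0; pose k := `|l| + `|m| + 1.
have k0 : 0 < k by rewrite ltr_wpDl ?addr_ge0.
pose d := Num.min 1 (eps / k).
have d0 : 0 < d by rewrite lt_min ltr01 divr_gt0.
apply: far_mp (far_and (fl _ d0) (hm _ d0)) => i _ [H H'].
have -> : f i * h i - l * m = (h i - m) * l + (f i - l) * m + (f i - l) * (h i - m).
  by ring.
apply: (@le_trans _ _ (d * k)); last first.
  by rewrite -ler_pdivlMr // ge_min lexx orbT.
rewrite /k [d * _]mulrDr mulr1 [d * _]mulrDr.
apply: le_trans (ler_normD _ _) _; apply: lerD.
  by apply: le_trans (ler_normD _ _) _; rewrite !normrM lerD // ler_wpM2r.
rewrite normrM -[leRHS]mulr1 ler_pM //; apply: le_trans H' _.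
by rewrite ge_min lexx.
Qed.

Lemma tends_continuous Phi f l (k : R -> R) :
  {for l, continuous k} -> tends Phi f l -> tends Phi (fun i => k (f i)) (k l).
Proof.
move=> /cvgrPdist_le ck fl eps /ck /nbhs_ballP[d /= d0 H].
have d2 : 0 < d / 2 by rewrite divr_gt0.
apply: far_mp (fl _ d2) => i _ le_d.
rewrite distrC; apply: H; rewrite /ball /= distrC (le_lt_trans le_d) //.
by rewrite ltr_pdivrMr // ltr_pMr // ltr1n.
Qed.

Lemma tendsV Phi f l : l != 0 -> tends Phi f l -> tends Phi (fun i => (f i)^-1) l^-1.
Proof. by move=> l0; apply: tends_continuous; exact: inv_continuous. Qed.

Lemma tends_powR Phi f l a :
  0 < l -> tends Phi f l -> tends Phi (fun i => f i `^ a) (l `^ a).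
Proof.
move=> l0; have c : {for l, continuous (fun x : R => x `^ a)}.
  apply/differentiable_continuous/derivable1_diffP/derivable_powR.
  by rewrite in_itv /= l0.
exact: tends_continuous c.
Qed.

Lemma zgrowth_tends0 N d Phi : (0 < N)%N -> d < 0 ->
  tends Phi (fun i => zgrowth R N d (sz i)) 0.
Proof.
move=> N0 d0 eps eps0.
have [|Q HQ] := @powR_small R (d%:~R / N%:R) eps _ eps0.
  by rewrite pmulr_llt0 ?ltrz0 // invr_gt0 ltr0n.
exists Q => i _ /HQ.
by rewrite subr0 ger0_norm ?powR_ge0.
Qed.

Lemma uniform_littleoP Phi f N p : (0 < N)%N ->
  uniform_littleo sz Phi (fun i => f i - p.2 * growth R N p.1 (sz i))
    (fun i => growth R N p.1 (sz i)) <->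
  tends Phi (fun i => f i / growth R N p.1 (sz i)) p.2.
Proof.
move=> N0.
have E i : (0 < sz i)%N -> `|f i / growth R N p.1 (sz i) - p.2| =
    `|f i - p.2 * growth R N p.1 (sz i)| / growth R N p.1 (sz i).
  move=> si; have g0 := @zgrowth_gt0 R N p.1 (sz i) si.
  rewrite zgrowth_nat in g0.
  rewrite -[in RHS](ger0_norm (ltW g0)) -normf_div; congr `|_|.
  by rewrite (ger0_norm (ltW g0)) mulrBl mulfK // gt_eqF.
split=> H eps /H; apply: far_mp => i si; rewrite E // ler_pdivrMr //.
  by have := @zgrowth_gt0 R N p.1 (sz i) si.
by have := @zgrowth_gt0 R N p.1 (sz i) si.
Qed.

End Far.

Section Estimates.
Variables (R : realType) (N : nat) (J : Type) (sz : J -> nat).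
Hypothesis N_gt0 : (0 < N)%N.
Implicit Types (Phi : J -> Prop) (F : J -> R) (v w : option (int * R)).
Local Notation g := (zgrowth R N).

Definition est Phi F v : Prop :=
  match v with
  | None => far sz Phi (fun i => F i = 0)
  | Some p => 0 < p.2 /\ tends sz Phi (fun i => F i / g p.1 (sz i)) p.2
  end.

Lemma est_eq Phi F F' v :
  far sz Phi (fun i => F i = F' i) -> est Phi F v -> est Phi F' v.
Proof.
move=> FF'; case: v => [p|] /=; last first.
  by move=> F0; apply: far_mp (far_and FF' F0) => i _ [<-].
move=> [p0 H]; split=> //; apply: tends_eq H.
by apply: far_mp FF' => i _ ->.
Qed.

Lemma est_mono Phi Psi F v :
  (forall i, Psi i -> Phi i) -> est Phi F v -> est Psi F v.
Proof.
move=> PsiPhi; case: v => [p|] /=; last exact: far_mono.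
by move=> [p0 H]; split=> // eps /H; exact: far_mono.
Qed.

Definition vadd v w :=
  match v, w with
  | None, _ => w
  | _, None => v
  | Some p, Some q =>
      Some (if p.1 < q.1 then q else if q.1 < p.1 then p else (p.1, p.2 + q.2))
  end.

Definition vmul v w :=
  match v, w with
  | Some p, Some q => Some (p.1 + q.1, p.2 * q.2)
  | _, _ => None
  end.

Definition vinv v :=
  if v is Some p then Some (- p.1, p.2^-1) else None.

Lemma est1 Phi : est Phi (fun=> 1) (Some (0, 1)).
Proof.
split=> //=; apply: tends_eq (tends_cst _ _ _).
by apply: far_all => i; rewrite zgrowth0 divr1.
Qed.

Lemma tends_lower Phi F d e (mu : R) : d < e ->
  tends sz Phi (fun i => F i / g d (sz i)) mu ->
  tends sz Phi (fun i => F i / g e (sz i)) 0.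
Proof.
move=> de Fd; rewrite -[0](mulr0 mu).
have /(tendsM Fd) : tends sz Phi (fun i => g (d - e) (sz i)) 0.
  by apply: zgrowth_tends0; rewrite // subr_lt0.
apply: tends_eq; exists 0%N => i _ si.
by rewrite zgrowthD // zgrowthN mulrA divfK // gt_eqF ?zgrowth_gt0.
Qed.

Lemma est_add Phi F F' v w :
  est Phi F v -> est Phi F' w -> est Phi (fun i => F i + F' i) (vadd v w).
Proof.
case: v => [[d mu]|] /=; last first.
  by move=> F0; apply: est_eq; apply: far_mp F0 => i _ ->; rewrite add0r.
case: w => [[e nu]|] /=; last first.
  move=> H F0; apply: (@est_eq _ F _ (Some (d, mu))); last by [].
  by apply: far_mp F0 => i _ ->; rewrite addr0.
move=> [mu0 H] [nu0 H'].
have add e' l l' :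
    tends sz Phi (fun i => F i / g e' (sz i)) l ->
    tends sz Phi (fun i => F' i / g e' (sz i)) l' ->
    tends sz Phi (fun i => (F i + F' i) / g e' (sz i)) (l + l').
  move=> Hl Hl'; apply: tends_eq (tendsD Hl Hl').
  by apply: far_all => i; rewrite mulrDl.
case: (ltgtP d e) => [de|ed|E] /=.
- by split=> //; rewrite -[nu]add0r; apply: add H'; exact: tends_lower H.
- by split=> //; rewrite -[mu]addr0; apply: add H _; exact: tends_lower H'.
by split; [exact: addr_gt0 | apply: add H _; rewrite E].
Qed.

Lemma est_mul Phi F F' v w :
  est Phi F v -> est Phi F' w -> est Phi (fun i => F i * F' i) (vmul v w).
Proof.
case: v => [[d mu]|] /=; last first.
  by move=> F0 _; apply: far_mp F0 => i _ ->; rewrite mul0r.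
case: w => [[e nu]|] /=; last first.
  by move=> _ F0; apply: far_mp F0 => i _ ->; rewrite mulr0.
move=> [mu0 H] [nu0 H']; split; first exact: mulr_gt0.
apply: tends_eq (tendsM H H'); exists 0%N => i _ si.
by rewrite zgrowthD // invfM mulrACA.
Qed.

Lemma est_inv Phi F v : est Phi F v -> est Phi (fun i => (F i)^-1) (vinv v).
Proof.
case: v => [[d mu]|] /=; last by apply: far_mp => i _ ->; rewrite invr0.
move=> [mu0 H]; split; first by rewrite invr_gt0.
apply: tends_eq (tendsV (lt0r_neq0 mu0) H); apply: far_all => i.
by rewrite zgrowthN invfM.
Qed.

End Estimates.

Section Asymptotic.
Variables (R : realType) (N : nat) (L : language) (C : class L).
Hypothesis N_gt0 : (0 < N)%N.
Implicit Types G H : seq (sorts L).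
Local Notation fam G := (forall M : member C, tup M G -> R).
Local Notation index G := {M : member C & tup M G}.

(* The exponents in [v] may be negative: inverses of class sizes occur. *)
Definition asymptotic G (F : fam G) : Prop :=
  exists (T : finType) (cl : forall M : member C, tup M G -> T)
    (v : T -> option (int * R)),
    (forall t, definable (fun (M : member C) (a : tup M G) => cl M a == t)) /\
    forall t, est N (fun i : index G => msize (tag i))
      (fun i => cl (tag i) (tagged i) = t) (fun i => F (tag i) (tagged i)) (v t).

Lemma asymptotic_eq G (F F' : fam G) :
  (forall M a, F M a = F' M a) -> asymptotic F -> asymptotic F'.
Proof.
move=> E [T [cl [v [dcl e]]]]; exists T, cl, v; split=> // t.
by apply: est_eq (e t); exact: far_all.
Qed.

Lemma asymptotic_indicator G (P : forall M : member C, tup M G -> bool) :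
  definable P -> asymptotic (fun M a => (P M a)%:R).
Proof.
move=> dP; exists bool, P, (fun b => if b then Some (0, 1) else None).
split=> [b|[]]; first exact: definable_eqb.
  apply: est_eq (@est1 R N _ _ _).
  by exists 0%N => i /= -> _.
by exists 0%N => i /= -> _.
Qed.

Lemma asymptotic_lift2 G (F F' : fam G) (op : R -> R -> R)
    (vop : option (int * R) -> option (int * R) -> option (int * R)) :
  (forall Phi v w,
    est N (fun i : index G => msize (tag i)) Phi (fun i => F (tag i) (tagged i)) v ->
    est N (fun i : index G => msize (tag i)) Phi (fun i => F' (tag i) (tagged i)) w ->
    est N (fun i : index G => msize (tag i)) Phi
      (fun i => op (F (tag i) (tagged i)) (F' (tag i) (tagged i))) (vop v w)) ->
  asymptotic F -> asymptotic F' -> asymptotic (fun M a => op (F M a) (F' M a)).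
Proof.
move=> H [T [cl [v [dcl e]]]] [T' [cl' [v' [dcl' e']]]].
exists (T * T')%type, (fun M a => (cl M a, cl' M a)).
exists (fun t => vop (v t.1) (v' t.2)); split=> [[t t']|[t t'] /=].
  by apply: definable_eq (definable_and (dcl t) (dcl' t')) => M a.
apply: H; [apply: est_mono (e t) | apply: est_mono (e' t')].
  by move=> i [].
by move=> i [].
Qed.

Lemma asymptotic_add G (F F' : fam G) :
  asymptotic F -> asymptotic F' -> asymptotic (fun M a => F M a + F' M a).
Proof. by apply: asymptotic_lift2 => Phi v w; exact: est_add. Qed.

Lemma asymptotic_mul G (F F' : fam G) :
  asymptotic F -> asymptotic F' -> asymptotic (fun M a => F M a * F' M a).
Proof. by apply: asymptotic_lift2 => Phi v w; exact: est_mul. Qed.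

Lemma asymptotic_inv G (F : fam G) :
  asymptotic F -> asymptotic (fun M a => (F M a)^-1).
Proof.
move=> [T [cl [v [dcl e]]]]; exists T, cl, (fun t => vinv (v t)).
by split=> // t; exact: est_inv.
Qed.

Lemma asymptotic_bigsum (T : finType) G (F : T -> fam G) :
  (forall t, asymptotic (F t)) -> asymptotic (fun M a => \sum_t F t M a).
Proof.
move=> aF; elim: (index_enum T) => [|t l IH].
  apply: asymptotic_eq (asymptotic_indicator (definable_false _ G)) => M a.
  by rewrite big_nil.
apply: asymptotic_eq (asymptotic_add (aF t) IH) => M a.
by rewrite big_cons.
Qed.

Hypothesis C_asymptotic : asymptotic_class R N C.

Lemma asymptotic_count s G (P : forall M : member C, tup M (s :: G) -> bool) :
  definable P ->
  asymptotic (fun M (a : tup M G) =>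
    #|[pred x : M s | P M ((x, a) : tup M (s :: G))]|%:R).
Proof.
move=> [phi E]; have [D [theta [Drange Dpart De]]] := C_asymptotic.2 s G phi.
have cell M (a : tup (M : member C) G) :
    exists t : seq_sub D, forall t', sat (theta (val t')) a = (t == t').
  have [p [[Dp pa] up]] := Dpart M a.
  exists (SeqSub Dp) => t'; apply/idP/eqP => [t'a|<- //].
  by apply/val_inj/up; split=> //; exact: valP.
pose cl M a := projT1 (cid (cell M a)).
have clE M a t : sat (theta (val t)) a = (cl M a == t).
  by rewrite /cl; case: cid.
exists (seq_sub D), cl, (fun t => if 0 < (val t).2
  then Some (Posz (val t).1, (val t).2) else None).
split=> t; first by exists (theta (val t)) => M a; exact: clE.
have Et (i : index G) : cl (tag i) (tagged i) = t -> sat (theta (val t)) (tagged i).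
  by move=> clt; rewrite clE clt.
have {}De := De _ (valP t).
have Ecard (M : member C) (a : tup M G) :
    #|[pred x : M s | P M ((x, a) : tup M (s :: G))]| =
    #|[pred x : M s | sat phi ((x, a) : tup M (s :: G))]|.
  by apply: eq_card => x; rewrite !inE E.
case: ifPn => t0.
  split=> //=; apply/(uniform_littleoP _ _ _ (val t)) => // eps eps0.
  have [Q HQ] := De _ eps0; exists Q => i /Et it Qi.
  by rewrite Ecard; exact: HQ.
have tz : val t = (0%N, 0).
  by have /orP[/andP[_ t0']|/eqP] := allP Drange _ (valP t); first by rewrite t0' in t0.
have [|Q HQ] := De (1 / 2); first by rewrite divr_gt0.
exists Q => i /Et it Qi; rewrite Ecard.
have := HQ _ it Qi; rewrite tz mul0r subr0 /growth mul0r powRr0 mulr1.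
rewrite normr_nat; case: #|_| => [//|n] le2; exfalso.
have : (1 : R) <= 1 / 2 by apply: le_trans le2; rewrite ler1n.
by rewrite ler_pdivlMr // mul1r lern1.
Qed.

Lemma asymptotic_sum1 s G (F : fam (s :: G)) :
  asymptotic F ->
  asymptotic (fun M (a : tup M G) =>
    \sum_(x : M s) F M ((x, a) : tup M (s :: G))).
Proof.
move=> [T [cl [v [dcl e]]]].
pose S t (M : member C) (a : tup M G) :=
  \sum_(x : M s | cl M ((x, a) : tup M (s :: G)) == t) F M ((x, a) : tup M (s :: G)).
apply: (@asymptotic_eq _ (fun M a => \sum_t S t M a)) => [M a|].
  by rewrite (partition_big (fun x : M s => cl M ((x, a) : tup M (s :: G))) xpredT).
apply: asymptotic_bigsum => t.
have [T' [cl' [v' [dcl' e']]]] := asymptotic_count (dcl t).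
exists T', cl', (fun t' => vmul (v t) (v' t')); split=> // t'.
have {e} := e t; have {e'} := e' t'.
case: (v t) => [[d mu]|] /= en; last first.
  move=> [Q HQ]; exists Q => -[M a] /= _ Qi; rewrite /S big1 // => x /eqP xt.
  exact: (HQ (existT _ M ((x, a) : tup M (s :: G)))).
move=> [mu0 H]; case: (v' t') en => [[e nu]|] /=; last first.
  move=> [Q HQ]; exists Q => -[M a] /= Mt' Qi; rewrite /S big_pred0 // => x.
  apply/negbTE/negP => xt; have /eqP := HQ (existT _ M a) Mt' Qi.
  by rewrite pnatr_eq0 /= => /eqP/card0_eq/(_ x); rewrite inE xt.
move=> [nu0 H']; split; first exact: mulr_gt0.
pose n (i : index G) : R := #|[pred x : tag i s |
  cl (tag i) ((x, tagged i) : tup (tag i) (s :: G)) == t]|%:R.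
pose sz (i : index G) := msize (tag i).
pose g d' (i : index G) := zgrowth R N d' (sz i).
pose Phi (i : index G) := cl' (tag i) (tagged i) = t'.
have nc : tends sz Phi (fun i => n i / g e i) nu by exact: H'.
rewrite -[mu * nu]addr0.
have diff0 : tends sz Phi
    (fun i => (S t (tag i) (tagged i) / g d i - mu * n i) / g e i) 0.
  move=> eps eps0; have nu1 : 0 < nu + 1 by rewrite addr_gt0.
  have [Q HQ] := H _ (divr_gt0 eps0 nu1).
  have [Q' HQ'] := nc _ ltr01.
  exists (maxn Q Q') => -[M a] Mt'; rewrite gtn_max => /andP[Qi Q'i] /=.
  have {HQ'} := HQ' (existT _ M a) Mt' Q'i.
  set i := existT _ M a; move=> le1.
  have si : (0 < sz i)%N by exact: leq_ltn_trans Qi.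
  have ge0 : 0 < g e i by exact: zgrowth_gt0.
  have nle : n i <= (nu + 1) * g e i.
    rewrite -ler_pdivrMr //.
    by move: le1; rewrite ler_norml lerBlDl => /andP[].
  rewrite subr0 normf_div (gtr0_norm ge0) ler_pdivrMr //.
  have -> : S t M a / g d i - mu * n i =
      \sum_(x : M s | cl M ((x, a) : tup M (s :: G)) == t)
        (F M ((x, a) : tup M (s :: G)) / g d i - mu).
    by rewrite sumrB sumr_const -mulr_suml mulr_natr.
  apply: (le_trans (ler_norm_sum _ _ _)).
  apply: (@le_trans _ _ (n i * (eps / (nu + 1)))).
    rewrite mulr_natl -sumr_const; apply: ler_sum => x xt.
    apply: (HQ (existT _ M ((x, a) : tup M (s :: G)))) => //.
    exact/eqP.
  by rewrite mulrCA ler_pM2l // ler_pdivrMr // mulrC.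
apply: tends_eq (tendsD (tendsM (tends_cst _ _ mu) nc) diff0).
exists 0%N => i _ si.
rewrite [in RHS]zgrowthD // -/(sz i) -/(g d i) -/(g e i).
by rewrite mulrBl mulrA addrC subrK invfM mulrA.
Qed.

Lemma asymptotic_sum G H (F : fam (H ++ G)) :
  asymptotic F ->
  asymptotic (fun M (a : tup M G) => \sum_(w : tup M H) F M (tcat w a)).
Proof.
elim: H F => [|s H IH] F aF.
  apply: asymptotic_eq aF => M a.
  by rewrite (big_pred1 tt) // => -[].
apply: asymptotic_eq (IH _ (asymptotic_sum1 aF)) => M a.
rewrite exchange_big pair_bigA /=.
by apply: eq_bigr => -[x w].
Qed.

End Asymptotic.

Section MoreFar.
Variables (R : realType) (J : Type) (sz : J -> nat).
Implicit Types (Phi : J -> Prop) (f h : J -> R) (l m : R).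

Lemma far_union (T : finType) Phi (Psi : T -> J -> Prop) (P : J -> Prop) :
  (forall i, Phi i -> exists t, Psi t i) ->
  (forall t, far sz (Psi t) P) -> far sz Phi P.
Proof.
move=> cover /choice[Q HQ]; exists (\max_t Q t)%N => i /cover[t Pt] lt.
by apply: HQ Pt _; apply: leq_ltn_trans lt; exact: leq_bigmax.
Qed.

Lemma far_pull (J' : Type) (sz' : J' -> nat) Phi (Psi : J' -> Prop)
    (P : J -> Prop) (P' : J' -> Prop) :
  (forall j, Psi j -> exists i, [/\ Phi i, sz i = sz' j & P i -> P' j]) ->
  far sz Phi P -> far sz' Psi P'.
Proof.
move=> H [Q HQ]; exists Q => j /H[i [Phii szi PP']]; rewrite -szi => Qi.
exact/PP'/HQ.
Qed.

Lemma est_pull (J' : Type) (sz' : J' -> nat) N Phi (Psi : J' -> Prop) F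
    (f : J' -> R) v :
  (forall j, Psi j -> exists i, [/\ Phi i, sz i = sz' j & F i = f j]) ->
  est N sz Phi F v -> est N sz' Psi f v.
Proof.
move=> H; case: v => [p|] /=.
  move=> [p0 e]; split=> // eps /e; apply: far_pull => j /H[i [Phii szi Fi]].
  by exists i; split; rewrite ?szi ?Fi.
by apply: far_pull => j /H[i [Phii szi Fi]]; exists i; split; rewrite ?szi ?Fi.
Qed.

Lemma far_resize (sz' : J -> nat) B k Phi (P : J -> Prop) :
  (forall i, sz' i <= B * sz i ^ k)%N -> far sz Phi P -> far sz' Phi P.
Proof.
move=> le [Q HQ]; exists (B * Q ^ k)%N => i Phii lt; apply: HQ => //.
rewrite ltnNge; apply/negP => leQ.
have := leq_trans lt (le i); rewrite ltnNge leq_mul2l.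
rewrite [X in _ || X](_ : _ = true) ?orbT //.
by case: k {le lt} => // k; rewrite leq_exp2r.
Qed.

Lemma tends_squeeze0 Phi f h :
  (forall i, (0 < sz i)%N -> 0 <= f i <= h i) -> tends sz Phi h 0 -> tends sz Phi f 0.
Proof.
move=> fh H eps /H; apply: far_mp => i /fh/andP[f0 le_fh]; rewrite !subr0 => le_h.
by rewrite ger0_norm //; exact: (le_trans le_fh (le_trans (ler_norm _) le_h)).
Qed.

Lemma tends_unique Phi f l m :
  tends sz Phi f l -> tends sz Phi f m -> l < m -> far sz Phi (fun=> False).
Proof.
move=> fl fm lm; have d0 : 0 < (m - l) / 3 by rewrite divr_gt0 // subr_gt0.
apply: far_mp (far_and (fl _ d0) (fm _ d0)) => i _ [H H'].
have : m - l <= (m - l) / 3 + (m - l) / 3.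
  rewrite [leLHS](_ : _ = (m - f i) + (f i - l)); last by ring.
  apply: lerD; apply: le_trans (ler_norm _) _ => //.
  by rewrite distrC.
rewrite -mulr2n -[_ *+ 2]mulr_natr mulrAC ler_pdivlMr // ler_pM2l ?subr_gt0 //.
by rewrite ler_nat.
Qed.

End MoreFar.

Section NatValued.
Variables (R : realType) (N K : nat) (J : Type) (sz : J -> nat).
Hypothesis N_gt0 : (0 < N)%N.

(* Values outside the admissible range only occur on cells where the function
   eventually vanishes or the size stays bounded. *)
Definition normalize (v : option (int * R)) : nat * R :=
  if v is Some (Posz d, mu) then if (d <= N * K)%N then (d, mu) else (0%N, 0)
  else (0%N, 0).

Lemma normalize_range v (Phi : J -> Prop) F :
  est N sz Phi F v -> dim_meas (N * K) (normalize v).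
Proof.
case: v => [[[d|d] mu] [mu0 _]|_]; rewrite /dim_meas ?eqxx ?orbT //=.
by case: ifPn => le; rewrite /= ?le ?eqxx ?orbT ?mu0.
Qed.

Lemma est_normalize (Phi : J -> Prop) (f : J -> nat) B v :
  (forall i, (f i <= B * sz i ^ K)%N) ->
  est N sz Phi (fun i => (f i)%:R) v ->
  uniform_littleo sz Phi
    (fun i => (f i)%:R - (normalize v).2 * growth R N (normalize v).1 (sz i))
    (fun i => growth R N (normalize v).1 (sz i)).
Proof.
move=> fB e; apply/(uniform_littleoP _ _ _ (normalize v)) => //.
case: v e => [[d mu]|] /=; last first.
  move=> f0; apply: tends_eq (tends_cst _ _ _).
  by apply: far_mp f0 => i _ ->; rewrite mul0r.
move=> [mu0 H]; case: d H => d H; last first.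
  have dlt : Negz d < 0 by [].
  apply: tends_eq (tends_lower N_gt0 dlt H).
  by apply: far_all => i; rewrite zgrowth0 /growth mul0r powRr0.
case: ifPn => //; rewrite -ltnNge => lt eps _.
have H0 : tends sz Phi (fun i => (f i)%:R / zgrowth R N d (sz i)) 0.
  apply: (@tends_squeeze0 _ _ _ _ _
    (fun i => B%:R * zgrowth R N (Posz (N * K) - Posz d) (sz i))).
    move=> i si; have g0 := @zgrowth_gt0 R N d (sz i) si.
    rewrite divr_ge0 ?(ltW g0) //= zgrowthD // zgrowthN mulrA.
    rewrite ler_pM2r ?invr_gt0 //.
    suff -> : zgrowth R N (Posz (N * K)) (sz i) = ((sz i) ^ K)%:R.
      by rewrite -natrM ler_nat.
    rewrite /zgrowth -[(Posz (N * K))%:~R]/((N * K)%:R) natrM mulrAC mulfV.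
      by rewrite mul1r powR_mulrn ?ler0n // natrX.
    by rewrite pnatr_eq0 -lt0n.
  rewrite -[0](mulr0 B%:R); apply: tendsM (tends_cst _ _ _) _.
  by apply: zgrowth_tends0; rewrite // subr_lt0 ltz_nat.
by apply: far_mp (tends_unique H0 H mu0).
Qed.

End NatValued.

Section Counting.
Variables (R : realType) (L L' : language) (r N : nat) (C : class L) (D : class L').
Variable I : interpretation r C D.
Hypothesis N_gt0 : (0 < N)%N.
Hypothesis C_asymptotic : asymptotic_class R N C.

Lemma asymptotic_count_target t G (phi : formula L' (t :: G)) :
  exists F : forall M : member C, tup M (reps_ctx I G ++ zctx I) -> R,
    asymptotic N F /\ forall (A : member D) w (a : tup A G), reprel w a ->
      #|[pred x : A t | sat phi ((x, a) : tup A (t :: G))]|%:R =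
      F (alpha I A) (tcat w (params (par I A))).
Proof.
have [psi E] := translate I phi.
pose Gam := us I t ++ (reps_ctx I G ++ zctx I).
pose cl (M : member C) (b : tup M Gam) : R :=
  \sum_(v : tup M (us I t)) (sat (delta I t) (tcat v (tsnd (tsnd b))) &&
    sat (epsilon I t) (tcat (tfst b) (tcat v (tsnd (tsnd b)))))%:R.
pose W (M : member C) (b : tup M Gam) : R :=
  (sat (delta I t) (tcat (tfst b) (tsnd (tsnd b))) &&
   sat psi (tcat (tcat (tfst b) (tfst (tsnd b)) : tup M (reps_ctx I (t :: G)))
     (tsnd (tsnd b))))%:R.
pose F (M : member C) (b : tup M (reps_ctx I G ++ zctx I)) : R :=
  \sum_(u : tup M (us I t)) W M (tcat u b) * (cl M (tcat u b))^-1.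
exists F; split.
  apply: (asymptotic_sum N_gt0 C_asymptotic (F := fun M b => W M b * (cl M b)^-1)).
  have i := projection_id (@struct L C) Gam.
  have p1 := projection_fst i.
  have p2 := projection_fst (projection_snd i).
  have p3 := projection_snd (projection_snd i).
  apply: (asymptotic_mul (F := W) (F' := fun M b => (cl M b)^-1)).
    apply: asymptotic_indicator; apply: definable_and.
      exact: definable_comp (definable_sat _ _) (projection_cat p1 p3).
    apply: definable_comp (definable_sat _ _) _.
    exact: projection_cat (projection_cat p1 p2) p3.
  apply: (asymptotic_inv (F := cl)).
  have i' := projection_id (@struct L C) (us I t ++ Gam).
  have q1 := projection_fst i'.
  have q2 := projection_fst (projection_snd i').
  have q3 := projection_snd (projection_snd (projection_snd i')).
  have := asymptotic_sum N_gt0 C_asymptotic (H := us I t) (G := Gam)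
    (asymptotic_indicator R N (definable_and
    (definable_comp (definable_sat _ (delta I t)) (projection_cat q1 q3))
    (definable_comp (definable_sat _ (epsilon I t))
       (projection_cat q2 (projection_cat q1 q3))))).
  apply: asymptotic_eq => M a; apply: eq_bigr => v _.
  by rewrite !tsnd_cat !tfst_cat.
move=> A w a wa; rewrite (@card_target _ _ _ _ _ I R A t _
  (fun u => sat psi (tcat (tcat u w : tup _ (reps_ctx I (t :: G)))
    (params (par I A))))).
  apply: eq_bigr => u _.
  rewrite /W /cl !tsnd_cat !tfst_cat inE; congr (_ * _^-1).
  by apply: eq_bigr => v _; rewrite inE.
move=> x u ux; rewrite (E _ _ ((x, a) : tup A (t :: G))) //=.
by rewrite tfst_cat ux tsnd_cat.
Qed.

Lemma asymptotic_size :
  exists F : forall M : member C, tup M (zctx I) -> R,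
    asymptotic N F /\ forall A : member D,
      (msize A)%:R = F (alpha I A) (params (par I A)).
Proof.
have /choice[F HF] := fun t => asymptotic_count_target
  (FImp FFalse FFalse : formula L' [:: t]).
exists (fun M z => \sum_t F t M z); split.
  by apply: asymptotic_bigsum => // t; have [] := HF t.
move=> A; rewrite /msize natr_sum; apply: eq_bigr => t _.
have [_ /(_ A tt tt erefl) <-] := HF t.
by congr _%:R; apply: eq_card => x; rewrite !inE.
Qed.

Lemma card_tup (M : structure L) G : (#|tup M G| <= msize M ^ size G)%N.
Proof.
elim: G => [|s G IH] /=; first by rewrite card_unit.
rewrite card_prod expnS leq_mul // /msize (bigD1 s) //=; exact: leq_addr.
Qed.

Lemma msize_target (A : member D) :
  (msize A <= #|sorts L'| * msize (alpha I A) ^ r)%N.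
Proof.
rewrite -sum_nat_const; apply: leq_sum => t _.
rewrite -{2}(size_tuple (us I t)); apply: leq_trans (card_tup _ _).
have /choice[f Ef] := @iota_neq0 _ _ _ _ _ I A t.
apply: (@leq_card _ _ f) => x y fxy.
have yx : f x \in Defs.iota I A y by rewrite fxy.
have [_ _ xy] := iota_equiv (Ef x) yx; have [_ _ xx] := iota_equiv (Ef x) (Ef x).
by apply/eqP; rewrite xy -xx.
Qed.

End Counting.

(** * The target class *)

Lemma definable_ffun (L : language) (K : Type) (St : K -> structure L) (U : finType)
    G (P : U -> forall k, tup (St k) G -> bool) (b : {ffun U -> bool} -> bool) :
  (forall u, definable (P u)) ->
  definable (fun k (a : tup (St k) G) => b [ffun u => P u k a]).
Proof.
move=> dP; apply: definable_eq (definable_exists (fun f : {ffun U -> bool} =>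
  definable_and (definable_const St G (b f))
    (definable_forall (fun u => definable_eqb (f u) (dP u))))) => k a.
apply/existsP/idP => [[f /andP[bf /forallP Ef]]|bP].
  by rewrite (_ : [ffun _ => _] = f) //; apply/ffunP => u; rewrite ffunE; exact/eqP.
by exists [ffun u => P u k a]; rewrite bP; apply/forallP => u; rewrite ffunE.
Qed.

Section SizePartition.
Variables (R : realType) (L L' : language) (r N : nat) (C : class L) (D : class L').
Variable I : interpretation r C D.

Lemma size_partition_exists :
  (0 < N)%N -> asymptotic_class R N C -> inhabited (size_partition I R N).
Proof.
move=> N0 aC; have [F [[T [cl [v [dcl e]]]] EF]] := asymptotic_size I N0 aC.
pose p t := normalize N r (v t).
have /choice[chi Echi] : forall q : nat * R, exists phi : formula L (zctx I),
    forall (M : member C) (z : tup M (zctx I)), sat phi z = (p (cl M z) == q).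
  move=> q; apply: definable_eq (definable_exists (fun t =>
    definable_and (definable_const (@struct L C) _ (p t == q)) (dcl t))) => M z.
  apply/existsP/idP => [[t /andP[pq /eqP ->]] //|pq].
  by exists (cl M z); rewrite pq eqxx.
apply: inhabits; apply: (@SizePartition _ _ _ _ _ I R N (codom p) chi).
- by apply/allP => q /codomP[t ->]; exact: normalize_range (e t).
- move=> A; exists (p (cl _ (params (par I A)))); split.
    by rewrite Echi eqxx codom_f.
  by move=> q [_]; rewrite Echi => /eqP.
move=> q _ eps eps0.
apply: (@far_union _ _ T _
  (fun t A => p t = q /\ cl _ (params (par I A)) = t)) => [A|t].
  by rewrite Echi => /eqP pq; exists (cl _ (params (par I A))).
have [<-|pq] := eqVneq (p t) q; last by exists 0%N => A [E]; rewrite E eqxx in pq.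
have := @est_normalize R N r (member D) (fun A => msize (alpha I A)) N0
  (fun A => cl _ (params (par I A)) = t) (fun A => msize A) #|sorts L'| (v t)
  (msize_target I).
have H : est N (fun A : member D => msize (alpha I A))
    (fun A => cl _ (params (par I A)) = t) (fun A => (msize A)%:R) (v t).
  apply: est_pull (e t) => A clA.
  by exists (existT _ (alpha I A) (params (par I A))); split=> //=; rewrite EF.
by move=> /(_ H _ eps0); apply: far_mono => A [].
Qed.

Lemma L_Q_gt0 (P : size_partition I R N) : (0 < L_Q P)%N.
Proof.
rewrite /L_Q; elim/big_ind: _ => // [m n m0 n0|e /asboolP[] //].
by rewrite lcmn_gt0 m0.
Qed.

Lemma dvdn_L_Q (P : size_partition I R N) e :
  (e <= N * r)%N -> E_Q P e -> (e %| L_Q P)%N.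
Proof.
move=> le Ee; rewrite /L_Q.
by apply: (biglcmn_sup (Ordinal (le : (e < (N * r).+1)%N))); first exact/asboolP.
Qed.

Section TargetCell.
Variables (P : size_partition I R N) (G : seq (sorts L')).
Variables (Psi : {A : member D & tup A G} -> Prop).
Variables (f : {A : member D & tup A G} -> nat) (v : option (int * R)) (q : nat * R).
Hypothesis N_gt0 : (0 < N)%N.
Hypothesis qP : q \in cells P.
Hypothesis Psi_chi : forall i, Psi i -> sat (chi P q) (params (par I (tag i))).
Hypothesis f_le : forall i, (f i <= msize (tag i))%N.
Hypothesis f_est :
  est N (fun i => msize (alpha I (tag i))) Psi (fun i => (f i)%:R) v.

Local Notation szM := (fun i : {A : member D & tup A G} => msize (alpha I (tag i))).
Local Notation szA := (fun i : {A : member D & tup A G} => msize (tag i)).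

Definition target_value : nat * R :=
  if v is Some (Posz d, mu) then
    if (d <= q.1)%N && `[< E_Q P q.1 >] then
      ((d * (L_Q P %/ q.1))%N, mu * q.2 `^ (- (d%:R / q.1%:R)))
    else (0%N, 0)
  else (0%N, 0).

Let q_range : (q.1 <= N * r)%N && (0 < q.2) || (q == (0%N, 0)).
Proof. exact: allP (cells_range P) _ qP. Qed.

Lemma E_Q_range : E_Q P q.1 -> (0 < q.1)%N /\ (q.1 <= N * r)%N /\ 0 < q.2.
Proof.
move=> [q0 _]; case/orP: q_range => [/andP[le l0] //|/eqP E].
by rewrite E in q0.
Qed.

Lemma target_value_range : dim_meas (L_Q P) target_value.
Proof.
rewrite /target_value; case: v f_est => [[[d|d] mu] [/= mu0 _]|_];
  rewrite /dim_meas ?eqxx ?orbT //=.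
case: ifPn => [/andP[de /asboolP Eq]|_]; last by rewrite eqxx orbT.
have [q0 [le l0]] := E_Q_range Eq.
suff le_LQ : (d * (L_Q P %/ q.1) <= L_Q P)%N by rewrite /= le_LQ mulr_gt0 ?powR_gt0.
by rewrite -[leqRHS](divnK (dvdn_L_Q le Eq)) mulnC leq_mul2l de orbT.
Qed.

Let resize (Q : _ -> Prop) : far szM Psi Q -> far szA Psi Q.
Proof.
apply: (@far_resize _ _ _ #|sorts L'| r) => i; exact: msize_target.
Qed.

Let size_tends :
  tends szM Psi (fun i =>
    (msize (tag i))%:R / zgrowth R N q.1 (msize (alpha I (tag i)))) q.2.
Proof.
have /(uniform_littleoP _ _ _ q N_gt0) H := chi_size qP.
move=> eps /H; apply: far_pull => i Psii.
by exists (tag i); split=> //; exact: Psi_chi.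
Qed.

Lemma small_cell : ~ E_Q P q.1 -> far szA Psi (fun=> False).
Proof.
move=> nE; have [q0|q0] := posnP q.1.
  have [Q HQ] := resize (size_tends ltr01).
  exists (maxn Q (Num.truncn (q.2 + 1))) => i Psii; rewrite gtn_max => /andP[Qi lt].
  have := HQ i Psii Qi; rewrite q0 zgrowth0 divr1 ler_norml lerBlDl => /andP[_ le].
  have := lt_le_trans (truncnS_gt _) (_ : (_.+1)%:R <= (msize (tag i))%:R :> R).
  move=> /(_ (q.2 + 1)); rewrite ler_nat => /(_ lt).
  by rewrite ltNge le.
have l0 : 0 < q.2.
  by case/orP: q_range => [/andP[]//|/eqP E]; rewrite E in q0.
apply: contrapT => nbd; apply: nE; split=> //; exists q.2; split=> //.
  by rewrite -surjective_pairing.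
move=> B; apply: contrapT => nA; apply: nbd; exists B => i Psii lt; apply: nA.
exists (tag i); split=> //.
by rewrite -surjective_pairing; exact: Psi_chi.
Qed.

Lemma target_cell :
  uniform_littleo szA Psi
    (fun i => (f i)%:R - target_value.2 * growth R (L_Q P) target_value.1 (szA i))
    (fun i => growth R (L_Q P) target_value.1 (szA i)).
Proof.
have LQ0 := L_Q_gt0 P; apply/(uniform_littleoP _ _ _ target_value) => //.
suff H : tends szM Psi
    (fun i => (f i)%:R / growth R (L_Q P) target_value.1 (szA i)) target_value.2
    \/ far szA Psi (fun=> False).
  by case: H => [H eps /H /resize //|H eps _]; exact: far_mp H.
have [Eq|nE] := pselect (E_Q P q.1); last by right; exact: small_cell.
have [q0 [le l0]] := E_Q_range Eq.
rewrite /target_value; case: v f_est => [[[d|d] mu] [/= mu0 H]|/= f0].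
- case: leqP => [de|lt] /=; last first.
    right; apply: resize.
    have lt' : Posz q.1 < Posz d by rewrite ltz_nat.
    have {}lt' := tends_lower N_gt0 lt' size_tends.
    apply: tends_unique _ H mu0; apply: tends_squeeze0 lt' => i si.
    rewrite divr_ge0 ?powR_ge0 //= ler_pM2r ?invr_gt0 ?zgrowth_gt0 //.
    by rewrite ler_nat.
  left; case: asboolP => //= _.
  apply: tends_eq (tendsM H (tends_powR (- (d%:R / q.1%:R)) l0 size_tends)).
  exists 0%N => i _ si.
  set m := (msize (tag i))%:R; set n := msize _ in si *.
  rewrite powRM ?invr_ge0 ?powR_ge0 //.
  have -> : (zgrowth R N q.1 n)^-1 `^ (- (d%:R / q.1%:R)) = zgrowth R N d n.
    rewrite -zgrowthN /zgrowth -powRrM; congr (_ `^ _).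
    have ? : q.1%:R != 0 :> R by rewrite pnatr_eq0 -lt0n.
    have ? : N%:R != 0 :> R by rewrite pnatr_eq0 -lt0n.
    by rewrite rmorphN /=; field; apply/andP.
  rewrite mulrCA divfK ?gt_eqF ?zgrowth_gt0 // mulrC powRN.
  congr (_ / _); rewrite /growth; congr (_ `^ _).
  rewrite natrM natf_div ?dvdn_L_Q //.
  have ? : q.1%:R != 0 :> R by rewrite pnatr_eq0 -lt0n.
  have ? : (L_Q P)%:R != 0 :> R by rewrite pnatr_eq0 -lt0n.
  by field; apply/andP.
- left; have dlt : Negz d < 0 by [].
  apply: tends_eq (tends_lower N_gt0 dlt H).
  by apply: far_all => i; rewrite zgrowth0 /growth mul0r powRr0.
left; apply: tends_eq (tends_cst _ _ _).
by apply: far_mp f0 => i _ ->; rewrite mul0r.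
Qed.

End TargetCell.

Lemma target_class (P : size_partition I R N) :
  separated_relative_qe I -> sentence_descent I ->
  (0 < N)%N -> asymptotic_class R N C -> asymptotic_class R (L_Q P) D.
Proof.
move=> qe sd N0 aC; split; first exact: L_Q_gt0.
move=> s G phi.
have [F [[T [cl [v [dcl e]]]] EF]] := asymptotic_count_target I N0 aC phi.
pose U := (seq_sub (cells P) * T)%type.
have /choice[psi Epsi] : forall u : U, exists psi : formula L' G,
    forall (A : member D) (a : tup A G), sat psi a =
    [exists w, reprel w a && ((sat (chi P (val u.1)) (params (par I A))) &&
       (cl _ (tcat w (params (par I A))) == u.2))].
  move=> u.
  have p2 := projection_snd (projection_id (@struct L C) (reps_ctx I G ++ zctx I)).
  have [theta Et] := definable_and
    (definable_comp (definable_sat _ (chi P (val u.1))) p2) (dcl u.2).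
  have [psi E] := trace_descent theta qe sd.
  exists psi => A a; rewrite E; apply: eq_existsb => w.
  by rewrite Et tsnd_cat.
pose f (i : {A : member D & tup A G}) : nat :=
  #|[pred x : tag i s | sat phi ((x, tagged i) : tup (tag i) (s :: G))]|.
pose Psi u (i : {A : member D & tup A G}) : Prop := sat (psi u) (tagged i).
pose value (u : U) := target_value P (v u.2) (val u.1).
have f_est u : est N (fun i => msize (alpha I (tag i))) (Psi u)
    (fun i => (f i)%:R) (v u.2).
  apply: est_pull (e u.2) => -[A a]; rewrite /Psi Epsi.
  move=> /existsP[w /and3P[wa _ /eqP clw]].
  exists (existT _ (alpha I A) (tcat w (params (par I A)))); split=> //=.
  exact/esym/EF.
have Psi_chi u i : Psi u i -> sat (chi P (val u.1)) (params (par I (tag i))).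
  by case: i => A a; rewrite /Psi Epsi => /existsP[w /and3P[]].
have f_le i : (f i <= msize (tag i))%N.
  rewrite (leq_trans (max_card _)) // /msize (bigD1 s) //=; exact: leq_addr.
have cover i : exists u, Psi u i.
  case: i => A a; have [q [[qP chiq] _]] := chi_partition P A.
  have [w wa] := reprel_onto I a.
  exists (SeqSub qP, cl _ (tcat w (params (par I A)))).
  by rewrite /Psi Epsi; apply/existsP; exists w; rewrite wa chiq /=.
pose first (g : {ffun U -> bool}) : nat * R :=
  if [pick u | g u] is Some u then value u else (0%N, 0).
have /choice[theta Etheta] : forall p : nat * R, exists th : formula L' G,
    forall (A : member D) (a : tup A G),
    sat th a = (first [ffun u => sat (psi u) a] == p).
  move=> p; apply: (definable_ffun (fun g => first g == p)) => u.
  exact: definable_sat.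
exists (codom first), theta; split.
- apply/allP => p /codomP[g ->]; rewrite /first.
  case: pickP => [u _|_]; last by rewrite /dim_meas eqxx orbT.
  exact: (target_value_range (valP u.1) (f_est u)).
- move=> A a; exists (first [ffun u => sat (psi u) a]); split.
    by rewrite Etheta eqxx codom_f.
  by move=> p [_]; rewrite Etheta => /eqP.
move=> p _ eps eps0.
apply: (@far_union _ _ U _ (fun u i => value u = p /\ Psi u i)) => [[A a]|u].
  rewrite Etheta /first; case: pickP => [u|none _].
    by rewrite ffunE => Pu /eqP <-; exists u.
  have [u Pu] := cover (existT _ A a); have := none u.
  by rewrite ffunE [sat _ _]Pu.
have [<-|pq] := eqVneq (value u) p; last by exists 0%N => i [E]; rewrite E eqxx in pq.
have := target_cell N0 (valP u.1) (Psi_chi u) f_le (f_est u) eps0.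
by apply: far_mono => i [].
Qed.

End SizePartition.

Theorem theorem8p15 (R : realType) (L L' : language) (r : nat)
    (C : class L) (D : class L') (I : interpretation r C D) :
  separated_relative_qe I ->
  sentence_descent I ->
  quotient_trace_reflecting I /\
  (forall N : nat, asymptotic_class R N C ->
     inhabited (size_partition I R N) /\
     forall P : size_partition I R N, asymptotic_class R (L_Q P) D).
Proof.
move=> qe sd; split; first exact: qe_descent_reflecting.
move=> N aC; have N0 := aC.1.
split=> [|P]; first exact: size_partition_exists.
exact: target_class.
Qed.
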